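(* Let $M$ be a sparse paving matroid of rank $2$ on $n$ elements. Then the $h^*$-polynomial $h^*(\mathscr{P}(M),x)$ is either $1$, or $1+x$, or a real-rooted polynomial of degree $\left\lfloor\frac{n}{2}\right\rfloor$ with positive coefficients.
   Context: For a matroid $M$ on $\{1,\ldots,n\}$ with set of bases $\mathscr{B}$, the matroid (base) polytope is $\mathscr{P}(M)=\operatorname{conv}\{e_B : B\in\mathscr{B}\}\subseteq\mathbb{R}^n$, where $e_B=\sum_{i\in B}e_i$. For a lattice polytope $\mathscr{P}\subseteq\mathbb{R}^n$ of dimension $d$, its Ehrhart polynomial $\operatorname{ehr}(\mathscr{P},t)$ is the polynomial in $t$ with $\operatorname{ehr}(\mathscr{P},t)=\#(t\mathscr{P}\cap\mathbb{Z}^n)$ for all integers $t\geq 0$, and its $h^*$-polynomial $h^*(\mathscr{P},x)$ is the polynomial defined by $\sum_{j\ge 0}\operatorname{ehr}(\mathscr{P},j)x^j=\frac{h^*(\mathscr{P},x)}{(1-x)^{d+1}}$. A matroid of rank $k$ is paving if all subsets of the ground set of size $k-1$ are independent; it is sparse paving if in addition every matroid hyperplane (flat of rank $k-1$) has size at most $k$. A polynomial is real-rooted if all its complex zeros are real. *)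

(* Defs.v *)
From HB Require Import structures.
From mathcomp Require Import all_boot all_order all_algebra finmap.
From mathcomp Require Import all_classical all_reals.
From mathcomp Require Import complex.

Set Implicit Arguments.
Unset Strict Implicit.
Unset Printing Implicit Defensive.

Import Order.TTheory GRing.Theory Num.Theory.
Local Open Scope classical_set_scope.
Local Open Scope ring_scope.

(* Matroids on the ground set 'I_n, axiomatized by their bases. *)
Record matroid (n : nat) := Matroid {
  bases : {set {set 'I_n}};
  bases_neq0 : bases != finset.set0;
  bases_exchange : forall B1 B2 : {set 'I_n}, B1 \in bases -> B2 \in bases ->
    forall x, x \in B1 :\: B2 ->
      exists2 y, y \in B2 :\: B1 & y |: (B1 :\ x) \in bases
}.

Section MatroidNotions.
Variables (n : nat) (M : matroid n).
Implicit Types S F : {set 'I_n}.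

Definition indep S : bool := [exists B in bases M, S \subset B].

Definition rk S : nat := (\max_(B in bases M) #|B :&: S|)%N.

Definition matroid_rank : nat := rk [set: 'I_n].

Definition flat F : bool := [forall x, (x \notin F) ==> (rk F < rk (x |: F))%N].

(* "rank k - 1" is written (rk F).+1 = k, to avoid the truncated subtraction
   when k = 0; similarly in paving. *)
Definition hyperplane F : bool := flat F && ((rk F).+1 == matroid_rank).

Definition paving : bool :=
  [forall S : {set 'I_n}, (#|S|.+1 == matroid_rank) ==> indep S].

Definition sparse_paving : bool :=
  paving && [forall F : {set 'I_n}, hyperplane F ==> (#|F| <= matroid_rank)%N].

End MatroidNotions.

Section Polytopes.
Variables (R : realType) (n : nat).
Implicit Types P V : set 'rV[R]_n.

Definition conv_hull V : set 'rV[R]_n :=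
  [set x | exists m (p : 'I_m -> 'rV[R]_n) (w : 'I_m -> R),
     [/\ forall i, V (p i), forall i, 0 <= w i,
         \sum_i w i = 1 & x = \sum_i w i *: p i]].

Definition indicator (B : {set 'I_n}) : 'rV[R]_n :=
  \sum_(i in B) delta_mx 0 i.

Definition base_polytope (M : matroid n) : set 'rV[R]_n :=
  conv_hull [set indicator B | B in [set B | B \in bases M]].

(* Dimension of the affine hull: the largest d such that P contains d + 1
   affinely independent points p 0, ..., p d (0 if P is empty). *)
Definition affine_dim P : nat :=
  (\max_(d < n.+1 | `[< exists2 p : 'I_d.+1 -> 'rV[R]_n, forall i, P (p i) &
      row_free (\matrix_(i < d) (p (lift ord0 i) - p ord0)) >]) d)%N.

Definition dilate (t : nat) P : set 'rV[R]_n := [set t%:R *: p | p in P].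

(* Cardinality of tP \cap Z^n; fset_set is the empty set on infinite sets, but
   for a bounded P the set below is finite. *)
Definition lattice_count P (t : nat) : nat :=
  #|` fset_set [set z : 'rV[int]_n | dilate t P (map_mx intr z)] |%fset.

Definition is_ehrhart P (p : {poly R}) : Prop :=
  forall t : nat, p.[t%:R] = (lattice_count P t)%:R.

Definition ehrhart P : {poly R} := xget 0 [set p | is_ehrhart P p].

(* The identity (1 - x)^(d+1) * \sum_j ehr(P, j) x^j = h(x) of formal power
   series, coefficient by coefficient (Cauchy product on the left). *)
Definition is_hstar P (h : {poly R}) : Prop :=
  forall m : nat, h`_m =
    \sum_(i < m.+1)
      ((1 - 'X) ^+ (affine_dim P).+1)`_i * (ehrhart P).[(m - i)%N%:R].

(* If no polynomial satisfied the defining property, ehrhart and hstar would be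
   the zero polynomial. *)
Definition hstar P : {poly R} := xget 0 [set h | is_hstar P h].

End Polytopes.

Arguments base_polytope R {n} M.

Definition real_rooted (R : realType) (p : {poly R}) : Prop :=
  forall z : complex R, root (map_poly (real_complex R) p) z -> z \is Num.real.

(* Main.v *)
(** A sparse paving matroid of rank 2 is given by an involution s of its ground
    set whose orbits are the parallel classes: {a, b} with a <> b is a base unless
    b = s a.  The lattice points of tP are the z >= 0 of sum 2t whose sum over
    each class is at most t.  At most one class can violate this, so writing
    A_s for the number of z in N^n of sum s and l for the number of two-element
    classes, the Ehrhart polynomial is
    A_2t - (n + l) A_(t-1) - l (n - 3) A_(t-2), and multiplying its generating
    series by (1 - x)^n gives
    H = sum_j C(n, 2j) x^j - (n + l) x - l (n - 3) x^2.
    With at least three classes P has dimension n - 1 and H is the h*-polynomial;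
    with two classes P has dimension n - 2 and h* = H / (1 - x).  The sum in H,
    evaluated at - tan^2 u and multiplied by cos^n u, is cos (n u); for n >= 6 the
    other terms are too small to change its sign at u = k pi / n, so H has enough
    sign changes to be real-rooted. *)
Require Import Defs.
From mathcomp Require Import all_boot all_order all_algebra finmap.
From mathcomp Require Import all_classical all_reals.
From mathcomp Require Import trigo.
From mathcomp Require polyrcf.
From mathcomp Require Import complex.
From mathcomp Require Import ring lra zify.

Set Implicit Arguments.
Unset Strict Implicit.
Unset Printing Implicit Defensive.

Import Order.TTheory GRing.Theory Num.Theory.
Local Open Scope ring_scope.

(** * Real-rootedness criteria *)

(** Dividing by the product of the ['X - r] over [rs] leaves a real factor of degree at most one, so
    a single zero not listed in [rs] is real as well. *)
Lemma real_rooted_of_roots (R : realType) (p : {poly R}) (rs : seq R) :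
    p != 0 -> uniq rs -> all (root p) rs -> (size p <= (size rs).+2)%N ->
  real_rooted p.
Proof.
move=> p0 urs rootrs sp z.
have urs' : uniq_roots rs by rewrite uniq_rootsE.
have /dvdpP [q pE] := uniq_roots_dvdp rootrs urs'.
have q0 : q != 0 by apply: contraNneq p0 => q0; rewrite pE q0 mul0r.
have sq : (size q <= 2)%N.
  move: sp; rewrite pE size_mul //; last first.
    by rewrite prodf_seq_neq0; apply/allP => x _ /=; rewrite polyXsubC_eq0.
  by rewrite size_prod_XsubC addnS -[X in (_ <= X)%N]addn2 addnC leq_add2l.
have real_ofR (x : R) : real_complex R x \is Num.real by rewrite complex_real.
rewrite pE rmorphM /= rootM => /orP[|].
  have {1}-> : q = q`_1 *: 'X + (q`_0)%:P.
    apply/polyP => i; rewrite coefD coefZ coefX coefC.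
    case: i => [|[|i]] /=; rewrite ?mulr0 ?mulr1 ?add0r ?addr0 //.
    by rewrite nth_default // (leq_trans sq).
  rewrite rmorphD /= map_polyZ /= map_polyX map_polyC /= => /rootP.
  rewrite hornerD hornerZ hornerX hornerC /= => /eqP.
  have [a0|a0] := eqVneq q`_1 0.
    rewrite a0 rmorph0 mul0r add0r => /eqP /complexI b0.
    case/negP: q0; apply/eqP/polyP => i; rewrite coef0.
    by case: i => [|[|i]] //; rewrite nth_default // (leq_trans sq).
  rewrite addr_eq0 => /eqP zE.
  have -> : z = real_complex R (- q`_0 / q`_1).
    rewrite rmorphM rmorphN fmorphV /= -zE mulrC mulKf //.
    by apply: contraNneq a0 => h; apply/eqP/complexI; rewrite h.
  exact: real_ofR.
rewrite rmorph_prod /= => h; have : z \in [seq real_complex R x | x <- rs].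
  rewrite -root_prod_XsubC big_map; apply: etrans h; congr root.
  by apply: eq_bigr => x _; rewrite rmorphB /= map_polyX map_polyC.
by case/mapP => x _ ->; exact: real_ofR.
Qed.

(** The intermediate value theorem gives a root in each of the d - 1 gaps. The degree is at most d,
    so at most one zero is left, and it is real too. *)
Lemma real_rooted_of_alternation (R : realType) (p : {poly R}) (d : nat)
    (y : nat -> R) :
    (size p <= d.+1)%N ->
    (forall k, (k.+1 < d)%N -> y k.+1 < y k) ->
    (0 < d)%N -> (forall k, (k < d)%N -> 0 < (-1) ^+ k * p.[y k]) ->
  real_rooted p.
Proof.
move=> sp ydec d0 ysgn.
have p0 : p != 0.
  by apply/eqP => p0; have := ysgn 0%N d0; rewrite p0 horner0 mulr0 ltxx.
(* The condition on [k] stays under the existential so that [choice] yields a total function. *)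
have root_between k : exists x : R,
    (k.+1 < d)%N -> (y k.+1 < x < y k) && root p x.
  case: (ltnP k.+1 d) => kd; last by exists 0.
  have [||x xI rx] := @polyrcf.poly_ivtoo R p (y k.+1) (y k).
  - exact/ltW/ydec.
  - have := mulr_gt0 (ysgn _ kd) (ysgn k (ltnW kd)).
    rewrite exprS mulN1r mulrACA mulNr -exprD addnn -mul2n exprM sqrrN expr1n.
    by rewrite expr1n mulN1r oppr_gt0.
  by exists x => _; rewrite rx andbT; move: xI; rewrite in_itv.
have [r rP] := choice root_between.
have rdec j k : (j < k)%N -> (k.+1 < d)%N -> r k < r j.
  elim: k => // k IH; rewrite ltnS leq_eqVlt => jk kd.
  have step : r k.+1 < r k.
    have /andP[/andP[_ h1] _] := rP _ kd.
    have /andP[/andP[h2 _] _] := rP _ (ltnW kd).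
    exact: lt_trans h1 h2.
  case/orP: jk => [/eqP -> //|jk]; exact: lt_trans step (IH jk (ltnW kd)).
apply: (@real_rooted_of_roots _ _ [seq r k | k <- iota 0 d.-1]) => //.
- rewrite map_inj_in_uniq ?iota_uniq // => j k.
  rewrite !mem_iota /= !add0n => jd kd E.
  case: (ltngtP j k) => [jk|kj|//].
  + have : r k < r j by apply: rdec => //; lia.
    by rewrite E ltxx.
  + have : r j < r k by apply: rdec => //; lia.
    by rewrite E ltxx.
- apply/allP => x /mapP[k]; rewrite mem_iota add0n /= => kd ->.
  by have /andP[] := rP k (ltac:(lia)).
- by rewrite size_map size_iota; lia.
Qed.

(** * The h*-polynomial and its roots *)

(** With O_n for the odd counterpart below, (1 + y)^n = E_n(y^2) + y O_n(y^2). *)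
Definition even_binomial_poly (R : nzRingType) (n : nat) : {poly R} :=
  \poly_(j < n.+1) 'C(n, j.*2)%:R.

Definition odd_binomial_poly (R : nzRingType) (n : nat) : {poly R} :=
  \poly_(j < n.+1) 'C(n, j.*2.+1)%:R.

Lemma coef_even_binomial_poly (R : nzRingType) n j :
  (even_binomial_poly R n)`_j = 'C(n, j.*2)%:R.
Proof. by rewrite coef_poly; case: ltnP => // h; rewrite bin_small //; lia. Qed.

Lemma coef_odd_binomial_poly (R : nzRingType) n j :
  (odd_binomial_poly R n)`_j = 'C(n, j.*2.+1)%:R.
Proof. by rewrite coef_poly; case: ltnP => // h; rewrite bin_small //; lia. Qed.

Lemma even_binomial_polyS (R : comNzRingType) n :
  even_binomial_poly R n.+1 = even_binomial_poly R n + 'X * odd_binomial_poly R n.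
Proof.
apply/polyP => j; rewrite coefD coefXM !coef_even_binomial_poly.
case: j => [|j]; first by rewrite !bin0 addr0.
by rewrite coef_odd_binomial_poly doubleS binS natrD.
Qed.

Lemma odd_binomial_polyS (R : comNzRingType) n :
  odd_binomial_poly R n.+1 = odd_binomial_poly R n + even_binomial_poly R n.
Proof.
apply/polyP => j; rewrite coefD !coef_odd_binomial_poly coef_even_binomial_poly.
by rewrite binS natrD.
Qed.

(** Real and imaginary parts of cos^n a (1 + i tan a)^n = e^(i n a), obtained by induction from the
    two recurrences and the addition formulas. *)
Lemma binomial_poly_tan (R : realType) (a : R) n : cos a != 0 ->
  cos a ^+ n * (even_binomial_poly R n).[- tan a ^+ 2] = cos (n%:R * a) /\
  cos a ^+ n * (tan a * (odd_binomial_poly R n).[- tan a ^+ 2]) =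
    sin (n%:R * a).
Proof.
move=> c0; have tE : cos a * tan a = sin a by rewrite /tan mulrC divfK.
elim: n => [|n [IHc IHs]].
  have -> : even_binomial_poly R 0 = 1.
    apply/polyP => -[|j]; rewrite coef_even_binomial_poly coef1 //.
  have -> : odd_binomial_poly R 0 = 0.
    by apply/polyP => -[|j]; rewrite coef_odd_binomial_poly coef0.
  by rewrite mul0r cos0 sin0 hornerC horner0 !mulr0 mulr1.
rewrite even_binomial_polyS odd_binomial_polyS !(hornerD, hornerM, hornerX).
rewrite -natr1 mulrDl mul1r cosD sinD -IHc -IHs -tE exprS.
by split; ring.
Qed.

(* The Taylor polynomial of degree 3 in T of (1 + T)^(n/2); for n = 7 the bound
   is obtained by squaring, and n + 2 follows from n. *)
Lemma expr_ge_taylor3 (R : realFieldType) (w T : R) (n : nat) :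
    1 <= w -> w ^+ 2 = 1 + T -> (6 <= n)%N ->
  1 + n%:R / 2 * T + n%:R * (n%:R - 2) / 8 * T ^+ 2
    + n%:R * (n%:R - 2) * (n%:R - 4) / 48 * T ^+ 3 <= w ^+ n.
Proof.
move=> w1 wT; have T0 : 0 <= T.
  by rewrite -(lerD2l 1) -wT addr0 exprn_ege1.
have T2 : 0 <= T ^+ 2 by exact: exprn_ge0.
have T3 : 0 <= T ^+ 3 by exact: exprn_ge0.
pose L (x : R) := 1 + x / 2 * T + x * (x - 2) / 8 * T ^+ 2
    + x * (x - 2) * (x - 4) / 48 * T ^+ 3.
move=> /subnK <-; set m := (n - 6)%N; rewrite -/(L _).
suff: L (m + 6)%:R <= w ^+ (m + 6) /\ L (m + 7)%:R <= w ^+ (m + 7) by case.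
elim: m => [|m [IH6 IH7]]; last first.
  split; first by rewrite addSnnS.
  have -> : (m.+1 + 7 = (m + 6) + 2)%N by lia.
  rewrite exprD wT.
  apply: (@le_trans _ _ (L (m + 6)%:R * (1 + T))); last first.
    by rewrite ler_wpM2r // addr_ge0.
  rewrite -subr_ge0 natrD; set x : R := (m + 6)%:R.
  have x6 : 6 <= x by rewrite ler_nat leq_addl.
  (* Multiplying by 1 + T raises the exponent x / 2 by one, so only a term of degree 4 survives in
     the difference. *)
  rewrite (_ : _ - _ = x * (x - 2) * (x - 4) / 48 * T ^+ 4); last first.
    by rewrite /L; field.
  by rewrite !mulr_ge0 ?subr_ge0 ?exprn_ge0 ?invr_ge0 // (le_trans _ x6) ?ler_nat.
rewrite !add0n; split.
  by rewrite (exprM w 2 3) wT /L -subr_ge0 le_eqVlt; apply/orP; left; apply/eqP; field.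
rewrite -(ler_pXn2r (n := 2)) ?nnegrE //; last 2 first.
- by rewrite /L; nra.
- by rewrite exprn_ge0 // (le_trans ler01).
rewrite -exprM (exprM w 2 7) wT -subr_ge0 /L.
have T4 : 0 <= T ^+ 4 by exact: exprn_ge0.
have T5 : 0 <= T ^+ 5 by exact: exprn_ge0.
have T6 : 0 <= T ^+ 6 by exact: exprn_ge0.
have T7 : 0 <= T ^+ 7 by exact: exprn_ge0.
rewrite (_ : _ - _ = (35 / 64) * T ^+ 4 + (119/64) * T ^+ 5 + (567/256) * T ^+ 6 + T ^+ 7).
  by lra.
by field.
Qed.

(* Both sides are affine in l, so it is enough to treat l = 0 and l = x / 2,
   where the difference is a sum of nonnegative terms. *)
Lemma perturbation_lt_taylor3 (R : realFieldType) (x l T : R) :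
    6 <= x -> 0 <= l -> l * 2 <= x -> 0 <= T ->
  `|(x + l) * T - l * (x - 3) * T ^+ 2| <
  1 + x / 2 * T + x * (x - 2) / 8 * T ^+ 2 + x * (x - 2) * (x - 4) / 48 * T ^+ 3.
Proof.
move=> x6 l0 lx T0; set L := (X in _ < X).
have x0 : 0 < x by lra.
have cub : 0 <= x * (x - 2) * (x - 4) / 48 * T ^+ 3.
  by rewrite !mulr_ge0 ?exprn_ge0 ?invr_ge0 //; lra.
set c := l * 2 / x.
have c0 : 0 <= c by rewrite !mulr_ge0 // invr_ge0 ltW.
have c1 : 0 <= 1 - c by rewrite subr_ge0 ler_pdivrMr // mul1r.
have interp (u v : R) : 0 < u -> 0 < v -> 0 < (1 - c) * u + c * v.
  move=> u0 v0; have [->|cn0] := eqVneq c 0; first by rewrite subr0; lra.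
  rewrite ltr_wpDl ?(mulr_ge0 c1 (ltW u0)) // mulr_gt0 //.
  by rewrite lt_neqAle eq_sym cn0.
have sq (a b : R) : 0 <= a -> 0 <= a * b ^+ 2.
  by move=> a0; rewrite mulr_ge0 // sqr_ge0.
rewrite ltr_norml; apply/andP; split; rewrite -subr_gt0.
- rewrite (_ : _ - _ = (1 - c) * (L + x * T) +
    c * (L + x * T * (3 / 2) - x / 2 * (x - 3) * T ^+ 2)); last first.
    by rewrite /c; field; rewrite gt_eqF.
  apply: interp.
    rewrite /L; have := sq (x * (x - 2) / 8) T.
    have -> : 0 <= x * (x - 2) / 8 by rewrite !mulr_ge0 ?invr_ge0 //; lra.
    have : 0 <= x * T by rewrite mulr_ge0 // ltW.
    by move=> ? /(_ isT); lra.
  (* The square absorbs the negative term in T^2; the coefficient 5 x^2 - 12 x - 44 left over is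
     positive for x >= 6. *)
  rewrite (_ : L + _ - _ = 1 + x * T * (2 * (1 - (3 * x - 10) / 32 * T) ^+ 2
       + (5 * x ^+ 2 - 12 * x - 44) / 1536 * T ^+ 2)); last by rewrite /L; field.
  rewrite ltr_pwDl // mulr_ge0 ?(mulr_ge0 (ltW x0)) // addr_ge0 ?sq //.
  by rewrite mulr_ge0 ?invr_ge0 //; nra.
- rewrite (_ : _ - _ = (1 - c) * (L - x * T) +
    c * (L - x * T * (3 / 2) + x / 2 * (x - 3) * T ^+ 2)); last first.
    by rewrite /c; field; rewrite gt_eqF.
  have pos (a b : R) : 0 < b -> 0 < (1 - a * T) ^+ 2 + b * T ^+ 2.
    move=> b0; have [->|T1] := eqVneq T 0; first by rewrite mulr0; lra.
    by rewrite ltr_wpDl ?sqr_ge0 // mulr_gt0 // exprn_even_gt0.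
  apply: interp.
    rewrite (_ : _ - _ = (1 - x / 4 * T) ^+ 2 + x * (x - 4) / 16 * T ^+ 2 +
      x * (x - 2) * (x - 4) / 48 * T ^+ 3); last by rewrite /L; field.
    by rewrite ltr_wpDr // pos // !mulr_gt0 ?invr_gt0 //; lra.
  rewrite (_ : _ + _ = (1 - x / 2 * T) ^+ 2 + x * (3 * x - 14) / 8 * T ^+ 2 +
      x * (x - 2) * (x - 4) / 48 * T ^+ 3); last by rewrite /L; field.
  by rewrite ltr_wpDr // pos // !mulr_gt0 ?invr_gt0 //; lra.
Qed.

Definition rank2_hstar_poly (R : nzRingType) (n l : nat) : {poly R} :=
  even_binomial_poly R n - (n + l)%:R *: 'X - (l * (n - 3))%:R *: 'X^2.

Lemma coef_rank2_hstar_poly (R : nzRingType) n l j :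
  (rank2_hstar_poly R n l)`_j =
    'C(n, j.*2)%:R - (n + l)%:R * (j == 1%N)%:R - (l * (n - 3))%:R * (j == 2)%:R.
Proof.
by rewrite !coefB coef_even_binomial_poly !coefZ coefX coefXn.
Qed.

Lemma size_rank2_hstar_poly (R : nzRingType) n l : (3 < n)%N ->
  (size (rank2_hstar_poly R n l) <= (n./2).+1)%N.
Proof.
move=> n3; apply/leq_sizeP => j hj; rewrite coef_rank2_hstar_poly.
have nj : (n < j.*2)%N by lia.
have /negbTE -> : j != 1%N by lia.
have /negbTE -> : j != 2%N by lia.
by rewrite bin_small // !mulr0 !subr0.
Qed.

(* At x = - tan^2 (k pi / n) the term even_binomial_poly R n equals
   (-1)^k / cos^n, which dominates the rest of rank2_hstar_poly. *)
Lemma real_rooted_rank2_hstar_poly (R : realType) n l :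
  (6 <= n)%N -> (l * 2 <= n)%N -> real_rooted (rank2_hstar_poly R n l).
Proof.
move=> n6 ln; pose a (k : nat) : R := k%:R * pi / n%:R.
have n0 : (0 : R) < n%:R by rewrite ltr0n; lia.
have a_ge0 k : 0 <= a k by rewrite !mulr_ge0 ?invr_ge0 ?pi_ge0 ?ler0n.
have a_lt k : (k < n./2)%N -> a k < pi / 2.
  move=> kn; rewrite /a mulrAC [ltRHS]mulrC ltr_pM2r ?pi_gt0 //.
  by rewrite ltr_pdivrMr // mulrC ltr_pdivlMr // -natrM ltr_nat; lia.
have a_gt k : - (pi / 2) < a k.
  by rewrite (lt_le_trans _ (a_ge0 k)) // oppr_lt0 divr_gt0 ?pi_gt0.
have a_inc k : a k < a k.+1.
  by rewrite /a ltr_pM2r ?invr_gt0 // ltr_pM2r ?pi_gt0 // ltr_nat.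
have cos_gt0 k : (k < n./2)%N -> 0 < cos (a k).
  by move=> kn; rewrite cos_gt0_pihalf // a_gt a_lt.
have tan_ge0 k : (k < n./2)%N -> 0 <= tan (a k).
  move=> kn; rewrite /tan divr_ge0 ?(ltW (cos_gt0 _ kn)) // sin_ge0_pi //.
  rewrite a_ge0 /= (le_trans (ltW (a_lt _ kn))) //.
  by rewrite ler_pdivrMr // ler_peMr ?pi_ge0 // ler1n.
apply: (@real_rooted_of_alternation _ _ n./2 (fun k => - tan (a k) ^+ 2)).
- by rewrite size_rank2_hstar_poly //; lia.
- move=> k kn; rewrite ltrN2 ltr_pXn2r ?nnegrE ?tan_ge0 //; last exact: ltnW.
  by rewrite ltr_tan ?a_inc // in_itv /= a_gt a_lt //; exact: ltnW.
- lia.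
move=> k kn; set c := cos (a k); set T := tan (a k) ^+ 2.
have c0 : 0 < c by exact: cos_gt0.
have cn0 : 0 < c ^+ n by rewrite exprn_gt0.
rewrite -(pmulr_rgt0 _ cn0) /rank2_hstar_poly !hornerD !hornerN !hornerZ hornerX.
rewrite hornerXn sqrrN -/T mulrCA.
rewrite (_ : c ^+ n * _ = cos (k%:R * pi) - c ^+ n * (- ((n%:R + l%:R) * T -
     l%:R * (n%:R - 3) * T ^+ 2))); last first.
  rewrite (_ : k%:R * pi = n%:R * a k); last by rewrite /a [RHS]mulrC divfK // gt_eqF.
  have [<- _] := binomial_poly_tan n (lt0r_neq0 c0).
  by rewrite -/c -/T natrD natrM natrB //; [ring | lia].
have -> : cos (k%:R * pi) = (-1) ^+ k :> R.
  elim: k {kn c T c0 cn0} => [|k IH]; first by rewrite mul0r cos0.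
  by rewrite -natr1 mulrDl mul1r cosDpi IH exprS mulN1r.
set g := (_ * T - _).
(* Divided by c^n this reads |g| < (1 / c)^n, and (1 / c)^2 = 1 + T is the relation required by the
   Taylor bound. *)
have gc : `|c ^+ n * - g| < 1.
  have w1 : 1 <= c^-1 by rewrite invf_ge1 // cos_le1.
  have wT : c^-1 ^+ 2 = 1 + T by rewrite /T -cos2_tan2 ?gt_eqF // exprVn.
  rewrite normrM normrN gtr0_norm // -ltr_pdivlMl // mulr1 -exprVn.
  apply: lt_le_trans (expr_ge_taylor3 w1 wT n6).
  apply: perturbation_lt_taylor3; rewrite ?ler0n ?ler_nat ?sqr_ge0 //.
  by rewrite -natrM ler_nat.
rewrite mulrBr -expr2 -exprM muln2 -mul2n exprM sqrrN !expr1n.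
rewrite subr_gt0 (le_lt_trans (ler_norm _)) //.
by rewrite normrM normrX normrN1 expr1n mul1r.
Qed.

(** Only the coefficients of x and x^2 are lowered; C(n, 2) > n + l and C(n, 4) > l (n - 3) follow
    from l <= n / 2 and n >= 5. *)
Lemma rank2_hstar_poly_coef_gt0 (R : realDomainType) n l j :
    (5 <= n)%N -> (l * 2 <= n)%N -> (j <= n./2)%N ->
  0 < (rank2_hstar_poly R n l)`_j.
Proof.
move=> n5 ln jn; rewrite coef_rank2_hstar_poly.
have [m nE] : exists m, n = m.+4.+1 by exists (n - 5)%N; lia.
case: j jn => [|[|[|j]]] jn /=; rewrite ?mulr0 ?subr0 ?mulr1 ?ltr0n.
- by rewrite bin_gt0.
- rewrite subr_gt0 ltr_nat (_ : 1.*2 = 2)%N //.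
  have := bin_ffact n 2; rewrite nE !ffactnS !ffactn0 !factS fact0 /=; nia.
- rewrite subr_gt0 ltr_nat (_ : 2.*2 = 4)%N //.
  have := bin_ffact n 4; rewrite nE !ffactnS !ffactn0 !factS fact0 /=.
  rewrite (_ : (m.+4.+1 - 3 = m.+2)%N) //; nia.
- by rewrite bin_gt0; lia.
Qed.

Lemma real_rooted_rank2_hstar_poly5 (R : realType) l :
  real_rooted (rank2_hstar_poly R 5 l).
Proof.
(* The case n = 5 is below the range of the Taylor bound. At x = - 1/2 the quadratic equals - 1/4
   whatever [l] is. *)
pose y (k : nat) : R := if k == 0%N then 0 else - 2^-1.
apply: (@real_rooted_of_alternation _ _ 2 y); first exact: size_rank2_hstar_poly.
- by case=> // _; rewrite /y /= oppr_lt0 invr_gt0.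
- by [].
have HE x : (rank2_hstar_poly R 5 l).[x] =
    1 + (5 - l%:R) * x + (5 - l%:R * 2) * x ^+ 2.
  rewrite (horner_coef_wide _ (size_rank2_hstar_poly R l (isT : 3 < 5)%N)).
  rewrite !big_ord_recl big_ord0 !coef_rank2_hstar_poly /= natrD natrM.
  have -> : 'C(5, 0.*2) = 1%N by [].
  have -> : 'C(5, (1 + 0).*2) = 10 by [].
  have -> : 'C(5, (1 + (1 + 0)).*2) = 5 by [].
  by rewrite natrB //; ring.
case=> [|[|k]] // _; rewrite HE /y /= ?expr0 ?expr1; lra.
Qed.

Lemma rank2_hstar_polyP (R : realType) n l : (5 <= n)%N -> (l * 2 <= n)%N ->
  let h := rank2_hstar_poly R n l in
  [/\ real_rooted h, size h = (n./2).+1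
    & forall i : nat, (i <= n./2)%N -> 0 < h`_i].
Proof.
move=> n5 ln; split.
- have [n6|n6] := leqP 6 n; first exact: real_rooted_rank2_hstar_poly.
  rewrite (_ : n = 5); first exact: real_rooted_rank2_hstar_poly5.
  by apply/eqP; rewrite eqn_leq n5 andbT.
- apply/eqP; rewrite eqn_leq size_rank2_hstar_poly ?(ltnW n5) //=.
  rewrite ltnNge; apply/negP => sn.
  have := rank2_hstar_poly_coef_gt0 R n5 ln (leqnn n./2).
  by rewrite nth_default // ltxx.
- by move=> i; exact: rank2_hstar_poly_coef_gt0.
Qed.

(** * Generating series *)

Section CauchyProduct.
Variable R : comNzRingType.
Implicit Types (p h : {poly R}) (u v : nat -> R) (n m : nat).

Definition cauchy_coef p u m : R := \sum_(i < m.+1) p`_i * u (m - i)%N.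

Definition seq_shift u m : R := if m is m'.+1 then u m' else 0.

(* The formal power series identity (1 - x)^n * \sum_t u t x^t = h. *)
Definition has_numerator n u h : Prop :=
  forall m, cauchy_coef ((1 - 'X) ^+ n) u m = h`_m.

Lemma cauchy_coefX p u m : cauchy_coef ('X * p) u m = cauchy_coef p (seq_shift u) m.
Proof.
case: m => [|m].
  by rewrite /cauchy_coef !big_ord_recl !big_ord0 coefXM /= mul0r mulr0.
rewrite /cauchy_coef big_ord_recl [RHS]big_ord_recr /= coefXM mul0r add0r subnn mulr0.
rewrite addr0; apply: eq_bigr => i _; rewrite coefXM /= subSS.
by rewrite subSn // -ltnS.
Qed.

Lemma cauchy_coef_shift p u m :
  cauchy_coef p (seq_shift u) m = seq_shift (cauchy_coef p u) m.
Proof.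
case: m => [|m]; first by rewrite /cauchy_coef big_ord1 subnn mulr0.
rewrite /cauchy_coef big_ord_recr /= subnn mulr0 addr0; apply: eq_bigr => i _.
by rewrite subSn // -ltnS.
Qed.

Lemma cauchy_coef_mul_oneBX p u m :
  cauchy_coef ((1 - 'X) * p) u m = cauchy_coef p (fun t => u t - seq_shift u t) m.
Proof.
transitivity (cauchy_coef p u m - cauchy_coef ('X * p) u m).
  rewrite /cauchy_coef -sumrB; apply: eq_bigr => i _.
  by rewrite -mulrBl [(1 - 'X) * p]mulrBl mul1r coefB.
by rewrite cauchy_coefX /cauchy_coef -sumrB; apply: eq_bigr => i _; rewrite mulrBr.
Qed.

Lemma has_numerator_ext n u v h : u =1 v -> has_numerator n u h -> has_numerator n v h.
Proof. by move=> uv H m; rewrite -H; apply: eq_bigr => i _; rewrite uv. Qed.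

Lemma has_numeratorS n u h :
  has_numerator n (fun t => u t - seq_shift u t) h -> has_numerator n.+1 u h.
Proof. by move=> H m; rewrite exprS cauchy_coef_mul_oneBX. Qed.

Lemma has_numeratorD n u v h g : has_numerator n u h -> has_numerator n v g ->
  has_numerator n (fun t => u t + v t) (h + g).
Proof.
move=> H G m; rewrite coefD -H -G /cauchy_coef -big_split /=.
by apply: eq_bigr => i _; rewrite mulrDr.
Qed.

Lemma has_numeratorZ n u h a : has_numerator n u h ->
  has_numerator n (fun t => a * u t) (a *: h).
Proof.
move=> H m; rewrite coefZ -H /cauchy_coef mulr_sumr.
by apply: eq_bigr => i _; rewrite mulrCA.
Qed.

Lemma has_numerator_shift n u h :
  has_numerator n u h -> has_numerator n (seq_shift u) ('X * h).
Proof.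
by move=> H m; rewrite cauchy_coef_shift coefXM; case: m => //= m; rewrite H.
Qed.

(** 1 - x is cancellable among power series. This is needed when the polytope has dimension n - 2,
    one less than usual. *)
Lemma has_numerator_cancel n u h :
  has_numerator n.+1 u ((1 - 'X) * h) -> has_numerator n u h.
Proof.
move=> H m; elim: m => [|m IH].
  have := H 0%N; rewrite exprS cauchy_coef_mul_oneBX mulrBl mul1r coefB coefXM /=.
  by rewrite subr0 => <-; rewrite /cauchy_coef !big_ord1 /= subr0.
have := H m.+1; rewrite exprS mulrBl mul1r mulrBl mul1r coefB coefXM /= -IH.
rewrite (_ : cauchy_coef (_ - _) _ _ = cauchy_coef ((1 - 'X) ^+ n) u m.+1 -
   cauchy_coef ('X * (1 - 'X) ^+ n) u m.+1); last first.
  by rewrite /cauchy_coef -sumrB; apply: eq_bigr => i _; rewrite -mulrBl coefB.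
by rewrite cauchy_coefX cauchy_coef_shift => /addIr.
Qed.

End CauchyProduct.

(** This is A_s on n coordinates. The predecessor is harmless for [n = 0], where the value is 1 at
    [s = 0] and 0 beyond. *)
Definition multichoose (n s : nat) : nat := 'C((n + s).-1, s).

Lemma multichoose_n0 n : multichoose n 0 = 1%N.
Proof. exact: bin0. Qed.

Lemma multichoose_0s s : multichoose 0 s = (s == 0%N).
Proof. by case: s => // s; rewrite /multichoose bin_small. Qed.

Lemma multichooseS n s :
  multichoose n.+1 s.+1 = (multichoose n.+1 s + multichoose n s.+1)%N.
Proof. by rewrite /multichoose !addSn !addnS /= binS addnC. Qed.

Section MultichooseSeries.
Variable R : comNzRingType.

Lemma has_numerator_multichoose n :
  has_numerator n (fun t => (multichoose n t)%:R : R) 1.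
Proof.
elim: n => [|n IH].
  move=> m; rewrite expr0 /cauchy_coef big_ord_recl coefC /= mul1r subn0 big1.
    by rewrite multichoose_0s addr0 coefC; case: m.
  by move=> i _; rewrite coefC /= mul0r.
apply: has_numeratorS; apply: has_numerator_ext IH => -[|t] /=.
  by rewrite !multichoose_n0 subr0.
by rewrite multichooseS natrD addrC addKr.
Qed.

(** Even and odd parts of 1 / (1 - y)^n = (1 + y)^n / (1 - y^2)^n, with x = y^2. They are proved
    together because the recurrences mix them. *)
Lemma has_numerator_multichoose_double n :
  has_numerator n (fun t => (multichoose n t.*2)%:R : R) (even_binomial_poly R n) /\
  has_numerator n (fun t => (multichoose n t.*2.+1)%:R : R) (odd_binomial_poly R n).
Proof.
elim: n => [|n [IHe IHo]].
  split=> m; rewrite expr0 /cauchy_coef big_ord_recl coefC /= mul1r subn0 big1.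
  - by rewrite multichoose_0s addr0 coef_even_binomial_poly; case: m.
  - by move=> i _; rewrite coefC /= mul0r.
  - by rewrite multichoose_0s addr0 coef_odd_binomial_poly.
  - by move=> i _; rewrite coefC /= mul0r.
rewrite even_binomial_polyS odd_binomial_polyS; split; apply: has_numeratorS.
- apply: has_numerator_ext (has_numeratorD IHe (has_numerator_shift IHo)) => t.
  case: t => [|t] /=; first by rewrite !multichoose_n0 subr0 addr0.
  by rewrite doubleS !multichooseS !natrD; ring.
- apply: has_numerator_ext (has_numeratorD IHo IHe) => t.
  case: t => [|t] /=; first by rewrite multichooseS !multichoose_n0 subr0 addrC natrD.
  by rewrite doubleS !multichooseS !natrD; ring.
Qed.

End MultichooseSeries.

(** The truncation in [n - 3] matters only for n < 3, where the formula is applied with l = 0. *)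
Definition rank2_ehrhart (R : comNzRingType) (n l t : nat) : R :=
  let u t : R := (multichoose n t)%:R in
  (multichoose n t.*2)%:R - (n + l)%:R * seq_shift u t
    - (l * (n - 3))%:R * seq_shift (seq_shift u) t.

Lemma has_numerator_rank2_ehrhart (R : comNzRingType) n l :
  has_numerator n (rank2_ehrhart R n l) (rank2_hstar_poly R n l).
Proof.
have [He _] := has_numerator_multichoose_double R n.
have H1 := has_numerator_shift (has_numerator_multichoose R n).
have H2 := has_numerator_shift H1; rewrite mulr1 in H1; rewrite mulr1 -expr2 in H2.
rewrite /rank2_hstar_poly -!scaleNr.
apply: has_numerator_ext (has_numeratorD (has_numeratorD He
  (has_numeratorZ (- (n + l)%:R) H1)) (has_numeratorZ (- (l * (n - 3))%:R) H2)) => t.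
by rewrite !mulNr.
Qed.

(** * Polynomiality of the count, and uniqueness of h* *)

Section EhrhartPolynomial.
Variable R : realType.

Definition multichoose_poly (n : nat) : {poly R} :=
  (n`!%:R^-1) *: \prod_(i < n) ('X + i.+1%:R%:P).

Lemma multichoose_poly_nat n s :
  (multichoose_poly n).[s%:R] = (multichoose n.+1 s)%:R.
Proof.
rewrite /multichoose_poly hornerZ horner_prod /multichoose addSn /=.
rewrite -[X in 'C(_, X)](addKn n) bin_sub ?leq_addr //.
have f0 : n`!%:R != 0 :> R by rewrite pnatr_eq0 -lt0n fact_gt0.
apply: (mulfI f0); rewrite mulVKf // -natrM mulnC bin_ffact ffact_prod natr_prod.
rewrite (reindex_inj rev_ord_inj) /=; apply: eq_bigr => i _.
rewrite hornerD hornerX hornerC -natrD; congr _%:R; have := ltn_ord i; lia.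
Qed.

Lemma multichoose_poly_neg n i :
  (0 < i <= n)%N -> (multichoose_poly n).[- i%:R] = 0.
Proof.
case: i => // i /= ni; rewrite /multichoose_poly hornerZ horner_prod.
rewrite (bigD1 (Ordinal ni)) //= hornerD hornerX hornerC addNr mul0r mulr0 //.
Qed.

(** A shifted sequence is padded with zeros, whereas a polynomial is translated; they agree because
    [q] vanishes at -1 and -2. The zero at -2 needs n > 2, unless its coefficient is killed by l =
    0. *)
Lemma rank2_ehrhart_poly n l : (1 < n)%N -> (l == 0%N) || (2 < n)%N ->
  exists q : {poly R}, forall t : nat, q.[t%:R] = rank2_ehrhart R n l t.
Proof.
case: n => [|[|n]] // _ ln; pose q := multichoose_poly n.+1.
exists (q \Po (2%:P * 'X) - (n.+2 + l)%:R *: (q \Po ('X - 1%:P))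
  - (l * (n.+2 - 3))%:R *: (q \Po ('X - 2%:P))) => t.
rewrite !hornerD !hornerN !hornerZ !horner_comp !hornerM !hornerD !hornerN !hornerX.
rewrite !hornerC -natrM mul2n multichoose_poly_nat /rank2_ehrhart.
congr (_ - _ * _ - _).
  case: t => [|t] /=; first by rewrite sub0r -[1]/(1%:R) multichoose_poly_neg.
  by rewrite -natr1 addrK multichoose_poly_nat.
case/orP: ln => [/eqP -> |n2]; first by rewrite !mul0r.
congr (_ * _); case: t => [|[|t]] /=.
- by rewrite sub0r multichoose_poly_neg.
- by rewrite (_ : 1 - 2 = - 1%:R :> R) ?multichoose_poly_neg //; ring.
- by rewrite -addn2 natrD addrK multichoose_poly_nat.
Qed.

(** [xget] returns an arbitrary witness, but the property defining h* reads the Ehrhart polynomial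
    only at naturals and fixes every coefficient, so the choice does not matter. *)
Lemma hstar_unique n (P : set 'rV[R]_n) (u : nat -> R) (q h : {poly R}) :
    (forall t, (lattice_count P t)%:R = u t) -> (forall t : nat, q.[t%:R] = u t) ->
    has_numerator (affine_dim P).+1 u h ->
  hstar P = h.
Proof.
move=> Pu qu hu.
have ehrE t : (ehrhart P).[t%:R] = u t.
  have : is_ehrhart P (ehrhart P).
    by apply: (@xgetPex _ 0 [set p | is_ehrhart P p]); exists q => t'; rewrite qu Pu.
  by move=> ->; exact: Pu.
have hstarh (g : {poly R}) : is_hstar P g <-> forall m, g`_m = h`_m.
  split=> H m; rewrite H -hu; apply: eq_bigr => i _; first by rewrite ehrE.
  by rewrite ehrE.
apply/polyP; apply/hstarh; apply: (@xgetPex _ 0 [set p | is_hstar P p]).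
by exists h; apply/hstarh.
Qed.

End EhrhartPolynomial.

(** * Counting compositions *)

Lemma card_ffun_sum_eq n s :
  #|[set g : {ffun 'I_n.+1 -> 'I_s.+1} | \sum_i (g i : nat) == s]|%N =
  multichoose n.+1 s.
Proof.
rewrite /multichoose addSn /= -[X in 'C(_, X)](addKn n) bin_sub ?leq_addr //.
rewrite -card_ord_partitions.
pose F (t : n.+1.-tuple 'I_s.+1) : {ffun 'I_n.+1 -> 'I_s.+1} := [ffun i => tnth t i].
rewrite -[RHS](@card_imset _ _ F); last first.
  by move=> t u /ffunP E; apply: eq_from_tnth => i; have := E i; rewrite !ffunE.
apply: eq_card => g; apply/idP/imsetP => [|[t]]; rewrite !inE => /eqP H.
  exists [tuple g i | i < n.+1]; last by apply/ffunP => i; rewrite ffunE tnth_mktuple.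
  rewrite inE big_tuple; apply/eqP; apply: etrans H.
  by apply: eq_bigr => i _; rewrite tnth_mktuple.
move=> ->; apply/eqP; apply: etrans H; rewrite big_tuple.
by apply: eq_bigr => i _; rewrite ffunE.
Qed.

Lemma leq_term_sum (I : finType) (F : I -> nat) i : (F i <= \sum_j F j)%N.
Proof. by rewrite (bigD1 i) //= leq_addr. Qed.

(** Subtracting [v] pointwise is a bijection onto all functions of sum [s - \sum_i v i]. *)
Lemma card_ffun_sum_ge n m s (v : 'I_n.+1 -> nat) : (s <= m)%N ->
  #|[set f : {ffun 'I_n.+1 -> 'I_m.+1} |
      [forall i, v i <= f i] && (\sum_i (f i : nat) == s)]|%N =
  if (\sum_i v i <= s)%N then multichoose n.+1 (s - \sum_i v i) else 0%N.
Proof.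
move=> sm; have sumge (f : {ffun 'I_n.+1 -> 'I_m.+1}) :
    [forall i, v i <= f i]%N -> (\sum_i v i <= \sum_i f i)%N.
  by move/forallP=> vf; apply: leq_sum => i _.
case: leqP => vs; last first.
  apply/eqP; rewrite cards_eq0; apply/eqP/setP => f; rewrite !inE.
  by apply/negP => /andP[/sumge vf /eqP E]; move: vf; rewrite E leqNgt vs.
set r := (s - _)%N; rewrite -card_ffun_sum_eq.
pose F (g : {ffun 'I_n.+1 -> 'I_r.+1}) : {ffun 'I_n.+1 -> 'I_m.+1} :=
  [ffun i => inord (g i + v i)].
have Fval g i : F g i = (g i + v i)%N :> nat.
  rewrite ffunE inordK // ltnS (leq_trans _ sm) // -(subnK vs) leq_add //.
    by rewrite -ltnS.
  exact: leq_term_sum.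
rewrite -(@card_imset _ _ F); last first.
  move=> g h E; apply/ffunP => i; apply/val_inj/eqP.
  by rewrite -(eqn_add2r (v i)) -!Fval E.
apply: eq_card => f; apply/idP/imsetP => [|[g]]; rewrite !inE.
  case/andP => /forallP vf /eqP fs.
  have fr i : (f i - v i < r.+1)%N.
    rewrite ltnS /r -fs -sumnB //; exact: (leq_term_sum (fun j => f j - v j)%N).
  exists [ffun i => inord (f i - v i)].
    rewrite inE; apply/eqP; transitivity (\sum_i (f i - v i))%N.
      by apply: eq_bigr => i _; rewrite ffunE inordK.
    by rewrite sumnB // fs.
  by apply/ffunP => i; apply: val_inj; rewrite /= Fval ffunE inordK // subnK.
move=> /eqP gs ->; apply/andP; split.
  by apply/forallP => i; rewrite Fval leq_addl.
apply/eqP; transitivity (\sum_i (g i + v i))%N.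
  by apply: eq_bigr => i _; rewrite Fval.
by rewrite big_split /= gs subnK.
Qed.

Lemma sum_indicator_mul (I : finType) (i : I) c : (\sum_k (k == i) * c = c)%N.
Proof.
rewrite (bigD1 i) //= eqxx mul1n big1 ?addn0 // => k /negbTE ->.
by rewrite mul0n.
Qed.

(** This is A_(s - c), set to 0 for c > s, where truncated subtraction would give 1. *)
Definition multichoose_below (n s c : nat) : nat :=
  if (c <= s)%N then multichoose n (s - c) else 0.

Section CountPairs.
Variables (n m s : nat).
Hypothesis sm : (s <= m)%N.
Local Notation fun_type := {ffun 'I_n.+1 -> 'I_m.+1}.
Implicit Types f : fun_type.

Definition sum_eq f : bool := (\sum_k (f k : nat) == s)%N.

Lemma card_sum_eq : #|[set f : fun_type | sum_eq f]| = multichoose n.+1 s.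
Proof.
have := card_ffun_sum_ge (fun _ : 'I_n.+1 => 0%N) sm; rewrite big1_eq subn0 /= => <-.
apply: eq_card => f; rewrite !inE; apply/esym/andb_idl => _.
exact/forallP.
Qed.

Lemma card_sum_eq_ge i c :
  #|[set f : fun_type | (c <= f i)%N && sum_eq f]| = multichoose_below n.+1 s c.
Proof.
have := card_ffun_sum_ge (fun k => (k == i) * c)%N sm.
rewrite sum_indicator_mul => H; rewrite /multichoose_below -H {H}.
apply: eq_card => f; rewrite !inE.
congr andb; apply/idP/forallP => [ci k|/(_ i)]; last by rewrite eqxx mul1n.
by case: eqP => [->|_]; rewrite ?mul1n ?mul0n.
Qed.

Lemma card_sum_eq_ge2 i j c e : i != j ->
  #|[set f : fun_type | [&& c <= f i, e <= f j & sum_eq f]%N]| =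
  multichoose_below n.+1 s (c + e).
Proof.
move=> ij; have := card_ffun_sum_ge (fun k => (k == i) * c + (k == j) * e)%N sm.
rewrite big_split /= !sum_indicator_mul => H; rewrite /multichoose_below -H {H}.
apply: eq_card => f; rewrite !inE.
rewrite andbA; congr andb; apply/andP/forallP => [[ci ej] k|H].
  case: (k =P i) => [->|_]; first by rewrite (negbTE ij) mul1n addn0.
  by case: eqP => [->|_]; rewrite ?mul1n ?mul0n.
have := H i; have := H j.
by rewrite !eqxx (negbTE ij) eq_sym (negbTE ij) !mul1n !mul0n addn0 add0n.
Qed.

(* Raising the lower bound on f i from c to c.+1 loses the functions with
   f i = c, which are those bounded below by (c, t - c) but not by (c.+1, t - c). *)
Lemma card_sum_eq_ge_pair i j t : i != j ->
  (#|[set f : fun_type | (t <= f i + f j)%N && sum_eq f]| + t * multichoose_below n.+1 s t.+1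
   = t.+1 * multichoose_below n.+1 s t)%N.
Proof.
move=> ij; pose S c := [set f : fun_type | [&& c <= f i, t <= f i + f j & sum_eq f]%N].
have step c : (c < t)%N -> (#|S c| + multichoose_below n.+1 s t.+1 =
    #|S c.+1| + multichoose_below n.+1 s t)%N.
  move=> ct; rewrite -[t.+1](_ : c.+1 + (t - c) = _)%N; last by lia.
  rewrite -[in RHS](_ : c + (t - c) = t)%N; last by lia.
  rewrite -!(card_sum_eq_ge2 _ _ ij); set A := [set f : fun_type | _].
  set B := [set f : fun_type | _].
  have SS : S c.+1 \subset S c.
    by apply/fintype.subsetP => f; rewrite !inE => /and3P[/ltnW -> -> ->].
  have AB : A \subset B.
    by apply/fintype.subsetP => f; rewrite !inE => /and3P[/ltnW -> -> ->].
  rewrite -(cardsID (S c.+1) (S c)) (finset.setIidPr SS) -addnA; congr (_ + _)%N.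
  rewrite -(cardsID A B) (finset.setIidPr AB) addnC; congr (_ + _)%N.
  apply: eq_card => f; rewrite !inE.
  by case: (sum_eq f); rewrite ?andbF //= !andbT; lia.
(* Descent from c = t, where [t <= f i] already implies the bound on the pair, to c = 0, where only
   that bound is left. *)
have S_sum d : (d <= t)%N -> (#|S (t - d)| + d * multichoose_below n.+1 s t.+1 =
    d.+1 * multichoose_below n.+1 s t)%N.
  elim: d => [|d IH] dt.
    rewrite subn0 mul0n mul1n addn0 -(card_sum_eq_ge i); apply: eq_card => f.
    rewrite !inE; case: (sum_eq f); rewrite ?andbF //= !andbT.
    by apply: andb_idr => /leq_trans; apply; exact: leq_addr.
  have := step (t - d.+1)%N; rewrite -subSn // subSS => st.
  have := IH (ltnW dt); have := st (ltac:(lia)); nia.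
by rewrite -(S_sum t) // subnn.
Qed.

End CountPairs.

Lemma multichoose_recr n s :
  (s.+1 * multichoose n s.+1 = (n + s) * multichoose n s)%N.
Proof.
case: n => [|n]; first by rewrite !multichoose_0s /=; case: s.
rewrite /multichoose addnS !addSn /= -{2}addSn mul_bin_diag //.
Qed.

(** * Classes of the involution and the points they bound *)

Section PartnerInvolution.
Variables (n : nat) (s : 'I_n -> 'I_n).
Hypothesis sK : involutive s.

Definition num_pairs : nat := #|[set i : 'I_n | i < s i]%N|.

Definition class_sum (f : 'I_n -> nat) i : nat := (\sum_(j in [set i; s i]) f j)%N.

Lemma class_sumE f i :
  class_sum f i = if s i == i then f i else (f i + f (s i))%N.
Proof.
rewrite /class_sum; case: eqP => [->|/eqP si]; first by rewrite finset.setUid big_set1.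
by rewrite big_setU1 ?big_set1 // inE eq_sym.
Qed.

Lemma class_sum_partner f i : class_sum f (s i) = class_sum f i.
Proof. by rewrite /class_sum sK finset.setUC. Qed.

(** [s] maps the complement of the first set bijectively onto {i | i < s i}. The first set holds one
    representative per class, so there are n - l classes. *)
Lemma num_reps_add_pairs : (#|[set i : 'I_n | i <= s i]%N| + num_pairs = n)%N.
Proof.
rewrite -[RHS]card_ord -(cardsC [set i : 'I_n | i <= s i]%N); congr (_ + _)%N.
rewrite /num_pairs -(card_imset _ (can_inj sK)); apply: eq_card => i.
rewrite inE -[i in LHS]sK mem_imset ?inE; last exact: can_inj sK.
by rewrite sK ltnNge.
Qed.

Lemma num_pairs_le : (num_pairs * 2 <= n)%N.
Proof.
rewrite -[X in (_ <= X)%N]num_reps_add_pairs muln2 -addnn leq_add2r.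
by apply/subset_leq_card/fintype.subsetP => i; rewrite !inE; exact: ltnW.
Qed.

Lemma two_class_sums_le f i j : j \notin [set i; s i] ->
  (class_sum f i + class_sum f j <= \sum_k f k)%N.
Proof.
rewrite !inE negb_or => /andP[ji jsi]; rewrite [leqRHS](bigID (mem [set i; s i])) /=.
rewrite leq_add2l [leqRHS](bigID (mem [set j; s j])) /=.
rewrite (eq_bigl (fun k => k \in [set j; s j])) ?leq_addr // => k.
rewrite !inE; apply: andb_idl => /orP[/eqP ->|/eqP ->]; first by rewrite negb_or ji.
rewrite negb_or (inj_eq (can_inj sK)) ji andbT.
by apply: contra jsi => /eqP <-; rewrite sK.
Qed.

End PartnerInvolution.

Lemma multichoose_below_double1 (R : comNzRingType) n t :
  (multichoose_below n t.*2 t.+1)%:R =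
  seq_shift (fun t => (multichoose n t)%:R : R) t.
Proof.
case: t => [|t] //=; rewrite /multichoose_below.
have -> : (t.+2 <= t.+1.*2)%N by lia.
by have -> : (t.+1.*2 - t.+2 = t)%N by lia.
Qed.

Lemma multichoose_below_double2 (R : comNzRingType) n t :
  (multichoose_below n t.*2 t.+2)%:R =
  seq_shift (seq_shift (fun t => (multichoose n t)%:R : R)) t.
Proof.
case: t => [|[|t]] //=; rewrite /multichoose_below.
have -> : (t.+4 <= t.+2.*2)%N by lia.
by have -> : (t.+2.*2 - t.+4 = t)%N by lia.
Qed.

Section CountPoints.
Variables (n : nat) (s : 'I_n.+1 -> 'I_n.+1).
Hypothesis sK : involutive s.

Definition polytope_points t : {set {ffun 'I_n.+1 -> 'I_(t.*2).+1}} :=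
  [set f : {ffun 'I_n.+1 -> 'I_(t.*2).+1} |
    sum_eq t.*2 f && [forall i, class_sum s (fun k => f k : nat) i <= t]%N].

(* A function of sum 2t has at most one class of sum greater than t. *)
Lemma card_polytope_points_add t :
  (#|polytope_points t| + \sum_(i : 'I_n.+1 | (i <= s i)%N)
     #|[set f : {ffun 'I_n.+1 -> 'I_(t.*2).+1} |
         (t < class_sum s (fun k => f k : nat) i)%N && sum_eq t.*2 f]|
   = multichoose n.+1 t.*2)%N.
Proof.
rewrite -(card_sum_eq n (leqnn t.*2)) -!sum1_card.
(* Double counting: for each function of sum 2t, either no class is violated or exactly one is. *)
under [X in (_ + X)%N]eq_bigr do rewrite -sum1_card big_mkcond.
rewrite exchange_big /= [X in (X + _)%N]big_mkcond [RHS]big_mkcond /= -big_split /=.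
apply: eq_bigr => f _; rewrite !inE; case: (boolP (sum_eq _ f)) => [fs|/negbTE fs] /=; last first.
  by rewrite big1 // => i _; rewrite inE fs andbF.
under eq_bigr do rewrite inE fs andbT.
case: (pickP (fun i => t < class_sum s (fun k => f k : nat) i)%N) => [i ti|nt].
  2: { rewrite big1 ?addn0 => [|i _]; last by rewrite nt.
       by case: forallP => // -[] i; rewrite leqNgt nt. }
have -> : [forall i, class_sum s (fun k => f k : nat) i <= t]%N = false.
  by apply/forallP => /(_ i); rewrite leqNgt ti.
wlog ri : i ti / (i <= s i)%N.
  move=> W; have [ri|/ltnW ri] := leqP i (s i); first exact: (W i).
  by apply: (W (s i)); rewrite ?class_sum_partner ?sK.
rewrite (bigD1 i) //= ti big1 // => j /andP[rj ji].
case: ltnP => // tj; have := two_class_sums_le sK (fun k => f k : nat) (i := i) (j := j).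
rewrite (eqP fs) !inE (negbTE ji) /=.
have -> : (j == s i) = false.
  apply/negP => /eqP E; case/eqP: ji; apply/val_inj/eqP.
  by rewrite eqn_leq {2}E ri andbT; move: rj; rewrite {2}E sK.
by move/(_ isT); lia.
Qed.

Lemma card_class_sum_gt (R : comNzRingType) t i :
  #|[set f : {ffun 'I_n.+1 -> 'I_(t.*2).+1} |
      (t < class_sum s (fun k => f k : nat) i)%N && sum_eq t.*2 f]|%:R
  = (multichoose_below n.+1 t.*2 t.+1)%:R + (s i != i)%:R * (t.+1%:R *
     ((multichoose_below n.+1 t.*2 t.+1)%:R - (multichoose_below n.+1 t.*2 t.+2)%:R)) :> R.
Proof.
case: (eqVneq (s i) i) => [si|si]; rewrite ?mul0r ?addr0 ?mul1r.
  rewrite -(card_sum_eq_ge (leqnn t.*2) i t.+1); congr _%:R; apply: eq_card => f.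
  by rewrite !inE class_sumE si eqxx.
have := card_sum_eq_ge_pair (leqnn t.*2) t.+1 (i := i) (j := s i).
rewrite eq_sym => /(_ si) /(congr1 (fun k => k%:R : R)); rewrite natrD !natrM.
move=> /(canRL (addrK _)) E; rewrite (_ : #|_| = #|[set f : {ffun 'I_n.+1 -> 'I_(t.*2).+1}
  | (t < f i + f (s i))%N && sum_eq t.*2 f]|).
  by rewrite E -natr1; ring.
by apply: eq_card => f; rewrite !inE class_sumE (negbTE si).
Qed.

Lemma card_polytope_points (R : comNzRingType) t :
    (num_pairs s == 0%N) || (2 < n.+1)%N ->
  #|polytope_points t|%:R = rank2_ehrhart R n.+1 (num_pairs s) t.
Proof.
move=> ln; have := card_polytope_points_add t.
move/(congr1 (fun k => k%:R : R)); rewrite natrD natr_sum.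
under eq_bigr do rewrite card_class_sum_gt.
set M1 := (multichoose_below _ _ t.+1)%:R; set M2 := (multichoose_below _ _ t.+2)%:R.
rewrite big_split /= sumr_const -mulr_suml -natr_sum.
have -> : (\sum_(i : 'I_n.+1 | (i <= s i)%N) (s i != i) = num_pairs s)%N.
  rewrite /num_pairs -sum1_card [RHS]big_mkcond [LHS]big_mkcond /=.
  apply: eq_bigr => i _; rewrite inE ltn_neqAle -val_eqE eq_sym.
  by case: (i <= s i)%N; rewrite ?andbT ?andbF //; case: eqP.
have M1E : M1 = seq_shift (fun t => (multichoose n.+1 t)%:R) t.
  exact: multichoose_below_double1.
have M2E : M2 = seq_shift (seq_shift (fun t => (multichoose n.+1 t)%:R)) t.
  exact: multichoose_below_double2.
(* With N the size of the ground set, (t - 1) A_(t-1) = (N + t - 2) A_(t-2) removes the factor t + 1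
   and leaves coefficients independent of t. *)
have key : t.+1%:R * (M1 - M2) = 2 * M1 + (n.+1%:R - 3) * M2.
  rewrite M1E M2E; case: t {M1 M2 M1E M2E} => [|[|t]] /=.
  - by rewrite subr0 !mulr0 addr0.
  - by rewrite multichoose_n0 subr0 !mulr0 addr0.
  have /(congr1 (fun k => k%:R : R)) := multichoose_recr n.+1 t.
  rewrite !natrM natrD => E; apply/eqP; rewrite -subr_eq0.
  rewrite -[_ - _](_ : t.+1%:R * (multichoose n.+1 t.+1)%:R -
    (n.+1%:R + t%:R) * (multichoose n.+1 t)%:R = _ :> R); first by rewrite E subrr.
  by rewrite -addn3 -[t.+1]addn1 !natrD; ring.
rewrite key => /(canRL (addrK _)) ->.
have repE : #|(fun i : 'I_n.+1 => (i <= s i)%N)|%:R = n.+1%:R - (num_pairs s)%:R :> R.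
  rewrite -[X in _ = X%:R - _](num_reps_add_pairs sK) natrD addrK; congr _%:R.
  by apply: eq_card => i; rewrite inE.
rewrite -[M1 *+ _]mulr_natr repE /rank2_ehrhart -M1E -M2E natrD natrM.
case/orP: ln => [/eqP ->|n3]; first by ring.
by rewrite natrB //; ring.
Qed.

End CountPoints.

(** * Parallel classes of a rank-2 matroid *)

(** Exchanging an element of [B1 :\: B2] for one of [B2 :\: B1] preserves the size of [B1] and
    shrinks the difference. *)
Lemma card_bases_eq n (M : matroid n) B1 B2 :
  B1 \in bases M -> B2 \in bases M -> #|B1| = #|B2|.
Proof.
move: {2}#|_|.+1 (ltnSn #|B1 :\: B2|) => k.
elim: k B1 => // k IH B1 Bk B1M B2M.
have [D0|[x xD]] := set_0Vmem (B1 :\: B2).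
  suff -> : B1 = B2 by [].
  have [D0'|[x xD]] := set_0Vmem (B2 :\: B1).
    by apply/eqP; rewrite finset.eqEsubset -!finset.setD_eq0 D0 D0' eqxx.
  by have [y] := bases_exchange B2M B1M xD; rewrite D0 inE.
have [y yD yM] := bases_exchange B1M B2M xD.
move: (xD) (yD); rewrite !inE => /andP[xB2 xB1] /andP[yB1 yB2].
rewrite -(IH _ _ yM B2M); last first.
  rewrite -ltnS (leq_trans _ Bk) // ltnS; apply/proper_card/fintype.properP; split.
    apply/fintype.subsetP => z; rewrite !inE => /andP[zB2 /orP[/eqP E|/andP[_ ->]]].
      by rewrite E yB2 in zB2.
    by rewrite zB2.
  exists x => //; rewrite !inE eqxx /= orbF negb_and negbK.
  by apply/orP; right; apply: contraNneq xB2 => ->.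
by rewrite cardsU1 !inE (negbTE yB1) andbF /= [in LHS](cardsD1 x) xB1.
Qed.

Section RankTwo.
Variables (n : nat) (M : matroid n).
Hypothesis (sparseM : sparse_paving M) (rankM : matroid_rank M = 2%N).

Lemma card_base2 B : B \in bases M -> #|B| = 2%N.
Proof.
move=> BM; move: rankM; rewrite /matroid_rank /rk => <-.
apply/eqP; rewrite eqn_leq; apply/andP; split.
  by rewrite -{1}(finset.setIT B) (leq_bigmax_cond (F := fun B => #|B :&: _|)).
by apply/bigmax_leqP => C CM; rewrite finset.setIT (card_bases_eq CM BM).
Qed.

Definition parallel x y : bool := (x == y) || ([set x; y] \notin bases M).

Lemma parallel_sym x y : parallel x y = parallel y x.
Proof. by rewrite /parallel eq_sym finset.setUC. Qed.

(** In rank 2 the paving condition concerns singletons: it says that there are no loops. *)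
Lemma base_through x : exists2 y, y != x & [set x; y] \in bases M.
Proof.
have /andP[/forallP pav _] := sparseM.
have := pav [set x]; rewrite cards1 rankM eqxx /= => /existsP[B /andP[BM]].
have /eqP/cards2P[a [b [ab BE]]] := card_base2 BM.
rewrite finset.sub1set BE !inE => /orP[/eqP xa|/eqP xb].
  by exists b; rewrite ?xa 1?eq_sym // -BE.
by exists a; rewrite ?xb // finset.setUC -BE.
Qed.

(** If {x, z} were a base, a base {y, w} could exchange w for x or z, which would make {x, y} or {y,
    z} a base. *)
Lemma parallel_trans x y z : parallel x y -> parallel y z -> parallel x z.
Proof.
rewrite /parallel; have [-> //|xy] /= := eqVneq x y; have [<-|yz] /= := eqVneq y z.
  by move=> -> _; rewrite orbT.
move=> xyM yzM; have [//|xz] /= := eqVneq x z; apply/negP => xzM.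
have [w wy ywM] := base_through y.
have [wxz|wxz] := boolP (w \in [set x; z]).
  move: wxz ywM; rewrite !inE => /orP[/eqP ->|/eqP ->]; last by rewrite (negbTE yzM).
  by rewrite finset.setUC (negbTE xyM).
have wD : w \in [set y; w] :\: [set x; z] by rewrite !inE eqxx orbT andbT; rewrite !inE in wxz.
have [u] := bases_exchange ywM xzM wD.
have -> : u |: [set y; w] :\ w = [set u; y].
  apply/setP => v; rewrite !inE; case: (eqVneq v w) => [->|_] /=.
    by rewrite (negbTE wy).
  by rewrite orbF.
rewrite !inE => /andP[_ /orP[/eqP ->|/eqP ->]]; first by rewrite (negbTE xyM).
by rewrite finset.setUC (negbTE yzM).
Qed.

(** A class has rank 1, since a base contains no two parallel elements, and any element outside
    raises the rank to 2. It is thus a hyperplane, and sparseness bounds its size. *)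
Lemma card_parallel_class x : (#|[set y | parallel x y]| <= 2)%N.
Proof.
have /andP[_ /forallP hyp] := sparseM.
set F := [set _ | _]; have := hyp F; rewrite rankM => /implyP; apply.
have rk1 (G : {set 'I_n}) : F \subset G -> (0 < rk M G)%N.
  move=> FG; have [y _ xyM] := base_through x.
  have := leq_bigmax_cond (F := fun B => #|B :&: G|) _ xyM; apply: leq_trans.
  apply/card_gt0P; exists x; rewrite !inE eqxx /= (fintype.subsetP FG) //.
  by rewrite inE /parallel eqxx.
have rkF : rk M F = 1%N.
  apply/eqP; rewrite eqn_leq rk1 // andbT; apply/bigmax_leqP => B BM.
  rewrite leqNgt; apply/negP => /card_gt1P[u [v []]].
  rewrite !inE => /andP[uB xu] /andP[vB xv] uv.
  have : parallel u v by apply: parallel_trans xv; rewrite parallel_sym.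
  rewrite /parallel (negbTE uv) /= => /negP; apply.
  suff <- : B = [set u; v] by [].
  apply/eqP; rewrite eq_sym finset.eqEcard cards2 uv card_base2 // andbT.
  by apply/fintype.subsetP => z; rewrite !inE => /orP[/eqP ->|/eqP ->].
rewrite /hyperplane rkF rankM eqxx andbT; apply/forallP => z; apply/implyP.
rewrite inE negb_or negbK => /andP[xz xzM]; rewrite rkF.
have := leq_bigmax_cond (F := fun B => #|B :&: (z |: F)|) _ xzM; apply: leq_trans.
suff -> : [set x; z] :&: (z |: F) = [set x; z] by rewrite cards2 xz.
apply/finset.setIidPl/fintype.subsetP => u; rewrite !inE => /orP[/eqP ->|->] //.
by rewrite /parallel eqxx /= orbT.
Qed.

Lemma exists_partner : exists2 s : 'I_n -> 'I_n, involutive s &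
  forall a b, a != b -> ([set a; b] \in bases M) = (b != s a).
Proof.
(* An element alone in its class is its own partner, through the default value. *)
pose s x := odflt x [pick y | (y != x) && parallel x y].
have par_s x : parallel x (s x).
  by rewrite /s; case: pickP => [y /andP[]//|_] /=; rewrite /parallel eqxx.
have sP x y : parallel x y -> x != y -> y = s x.
  move=> xy nxy; rewrite /s; case: pickP => [z /andP[zx xz] /=|/(_ y)]; last first.
    by rewrite eq_sym nxy xy.
  apply/eqP; apply: contraTT (card_parallel_class x) => yz; rewrite -ltnNge.
  apply: (@leq_trans #|[set x; y; z]|).
    rewrite finset.setUC cardsU1 !inE cards2 nxy negb_or zx eq_sym yz //.
  apply/subset_leq_card/fintype.subsetP => u; rewrite !inE -orbA.
  by case/or3P => /eqP -> //; rewrite /parallel eqxx.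
exists s => [x|a b ab].
  have [sx|sx] := eqVneq (s x) x; first by rewrite !sx.
  by apply/esym/sP => //; rewrite parallel_sym.
apply/idP/idP => [abM|].
  by apply: contraTneq (par_s a) => <-; rewrite /parallel negb_or ab abM.
by apply: contraNT => abM; apply/eqP/sP; rewrite // /parallel abM orbT.
Qed.

End RankTwo.

(** * Lattice points and dimension of the base polytope *)

Section BaseDecomposition.
Variables (n : nat) (M : matroid n) (s : 'I_n -> 'I_n).
Hypothesis sK : involutive s.
Hypothesis sM : forall a b, a != b -> ([set a; b] \in bases M) = (b != s a).

Lemma mem_class_sym i j : (j \in [set i; s i]) = (i \in [set j; s j]).
Proof.
rewrite !inE eq_sym; congr orb; apply/eqP/eqP => [->|->]; by rewrite sK.
Qed.

Lemma class_sum_mem f i j : j \in [set i; s i] -> class_sum s f j = class_sum s f i.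
Proof. by rewrite !inE => /orP[/eqP ->|/eqP ->] //; rewrite class_sum_partner. Qed.

Lemma class_eq_mem i j : j \in [set i; s i] -> [set j; s j] = [set i; s i].
Proof. by rewrite !inE => /orP[/eqP ->|/eqP ->] //; rewrite sK finset.setUC. Qed.

(* Greedy choice: remove a base whose first element lies in a class of largest
   sum and whose second one lies in a class of largest sum among the others. *)
Lemma base_decomposition t (g : 'I_n -> nat) :
    (\sum_i g i = t.*2)%N -> (forall i, class_sum s g i <= t)%N ->
  exists2 Bs : 'I_t -> {set 'I_n}, forall k, Bs k \in bases M &
    forall i, g i = (\sum_k (i \in Bs k))%N.
Proof.
elim: t g => [|t IH] g gs gc.
  exists (fun=> finset.set0) => [[]//|i]; rewrite big_ord0.
  by apply/eqP; rewrite -leqn0 -[X in (_ <= X)%N]gs leq_term_sum.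
have [a0 a0P] : exists a0, (0 < g a0)%N.
  have [a0 a0P|g0] := pickP (fun x => 0 < g x)%N; first by exists a0.
  suff : (\sum_i g i = 0)%N by rewrite gs.
  by apply: big1 => i _; have := g0 i; case: (g i).
case: (@arg_maxnP _ a0 (fun x => 0 < g x)%N (class_sum s g) a0P) => a ga amax.
pose Q x := (0 < g x)%N && (x \notin [set a; s a]).
(* Otherwise the class of [a] would carry the full sum 2 (t + 1), beyond its bound t + 1. *)
have [b0 b0P] : exists b0, Q b0.
  have [b0 b0P|g0] := pickP Q; first by exists b0.
  have := gc a; suff -> : class_sum s g a = t.+1.*2 by lia.
  rewrite -gs [RHS](bigID (mem [set a; s a])) /= [X in (_ + X)%N]big1 ?addn0 // => i ia.
  by have := g0 i; rewrite /Q ia andbT; case: (g i).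
case: (@arg_maxnP _ b0 Q (class_sum s g) b0P) => b /andP[gb ba] bmax.
have nab : a != b by apply: contraNneq ba => <-; rewrite !inE eqxx.
pose g' x := (g x - (x == a) - (x == b))%N.
have gE x : g x = (g' x + ((x == a) + (x == b)))%N.
  rewrite /g'; have [->|_] := eqVneq x a; first by rewrite (negbTE nab); lia.
  by have [->|_] := eqVneq x b; lia.
have sum1 (A : {set 'I_n}) y : (\sum_(x in A) (x == y) = (y \in A))%N.
  case: (boolP (y \in A)) => yA.
    by rewrite (bigD1 y) //= eqxx big1 // => x /andP[_ /negbTE ->].
  by rewrite big1 // => x xA; case: eqP => // E; rewrite -E xA in yA.
have classE i : class_sum s g i =
    (class_sum s g' i + ((a \in [set i; s i]) + (b \in [set i; s i])))%N.
  rewrite /class_sum -!sum1 -!big_split /=; apply: eq_bigr => x _; exact: gE.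
have g's : (\sum_i g' i = t.*2)%N.
  move: gs; rewrite (eq_bigr _ (fun x _ => gE x)) !big_split /=.
  have one y : (\sum_(x : 'I_n) (x == y) = 1)%N.
    transitivity (nat_of_bool (y \in [set: 'I_n]%SET)); last by rewrite finset.in_setT.
    rewrite -sum1.
    by apply: eq_bigl => x; rewrite finset.in_setT.
  by rewrite !one; lia.
have g'c i : (class_sum s g' i <= t)%N.
  have := gc i; rewrite classE.
  case: (boolP (a \in _)) => ai; first by lia.
  case: (boolP (b \in _)) => bi; first by lia.
  (* If a class missing [a] and [b] had sum t + 1, the maximal choices would force the same sum on
     the classes of [a] and [b]: three disjoint classes exceed the total 2 (t + 1). *)
  rewrite !addn0 leq_eqVlt ltnS => /orP[/eqP Et|//]; exfalso.
  have gi : class_sum s g i = t.+1 by rewrite classE (negbTE ai) (negbTE bi) addn0.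
  have [i' i'C gi'] : exists2 i', i' \in [set i; s i] & (0 < g i')%N.
    have [i' /andP[? ?]|g0] := pickP (fun x => (x \in [set i; s i]) && (0 < g x)%N).
      by exists i'.
    suff : class_sum s g i = 0%N by rewrite gi.
    by apply: big1 => x xC; have := g0 x; rewrite xC /=; case: (g x).
  have notC y : y \notin [set i; s i] -> i' \notin [set y; s y].
    apply: contra; rewrite mem_class_sym; move: i'C; rewrite !inE.
    by case/orP => /eqP ->; rewrite // sK orbC.
  have ca : class_sum s g a = t.+1.
    apply/eqP; rewrite eqn_leq gc -gi -(class_sum_mem g i'C); exact: amax.
  have cb : class_sum s g b = t.+1.
    apply/eqP; rewrite eqn_leq gc -gi -(class_sum_mem g i'C); apply: bmax.
    by rewrite /Q gi' notC.
  (* Erasing [g] at [i'] lowers the total but leaves the classes of [a] and [b] intact, so the bound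
     for two classes yields the contradiction. *)
  pose h x := (if x == i' then 0 else g x)%N.
  have hclass y : y \notin [set i; s i] -> class_sum s h y = class_sum s g y.
    move=> /notC i'y; apply: eq_bigr => x xy; rewrite /h; case: eqP => // E.
    by rewrite -E xy in i'y.
  have := two_class_sums_le sK h ba; rewrite !hclass // ca cb => hs.
  have : (\sum_k h k < \sum_k g k)%N; last by rewrite gs; lia.
  rewrite [X in (X < _)%N](bigD1 i') //= [X in (_ < X)%N](bigD1 i') //=.
  rewrite {1}/h eqxx add0n.
  rewrite (eq_bigr g) => [|x /negbTE xi']; last by rewrite /h xi'.
  lia.
have [Bs BsM BsE] := IH g' g's g'c.
exists (fun k : 'I_t.+1 => if unlift ord0 k is Some k' then Bs k' else [set a; b]).
  move=> k; case: unliftP => [k' _|_]; first exact: BsM.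
  by rewrite sM //; move: ba; rewrite !inE negb_or => /andP[].
move=> i; rewrite big_ord_recl unlift_none gE BsE addnC; congr (_ + _)%N.
  by rewrite !inE; case: (eqVneq i a) => // ->; rewrite (negbTE nab).
by apply: eq_bigr => k _; rewrite liftK.
Qed.

End BaseDecomposition.

Section LatticePoints.
Variables (R : realType) (n : nat) (M : matroid n.+1) (s : 'I_n.+1 -> 'I_n.+1).
Hypothesis sK : involutive s.
Hypothesis sM : forall a b, a != b -> ([set a; b] \in bases M) = (b != s a).
Hypothesis cardM : forall B, B \in bases M -> #|B| = 2%N.

Lemma indicatorE m (B : {set 'I_m}) i j : indicator R B i j = (j \in B)%:R.
Proof.
rewrite /indicator summxE (eq_bigr (fun k => (j == k)%:R)) => [|k _]; last first.
  by rewrite mxE ord1 eqxx.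
case: (boolP (j \in B)) => jB.
  by rewrite (bigD1 j) //= eqxx big1 ?addr0 // => k /andP[_]; rewrite eq_sym => /negbTE ->.
by rewrite big1 // => k kB; case: eqP => // E; rewrite E kB in jB.
Qed.

Lemma conv_hull_le m (V : set 'rV[R]_m) (c : 'I_m -> R) b x :
    (forall v, V v -> \sum_j c j * v 0 j <= b) -> conv_hull V x ->
  \sum_j c j * x 0 j <= b.
Proof.
move=> Vb [k [p [w [Vp w0 w1 ->]]]].
rewrite (_ : \sum_j _ = \sum_i w i * (\sum_j c j * p i 0 j)).
  rewrite -[b]mul1r -w1 mulr_suml ler_sum // => i _.
  by rewrite ler_wpM2l // Vb.
under eq_bigr do rewrite summxE mulr_sumr.
rewrite exchange_big; apply: eq_bigr => i _; rewrite mulr_sumr.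
by apply: eq_bigr => j _; rewrite mxE mulrCA.
Qed.

Lemma base_polytope_le (c : 'I_n.+1 -> R) b x :
    (forall B, B \in bases M -> \sum_(j in B) c j <= b) -> base_polytope R M x ->
  \sum_j c j * x 0 j <= b.
Proof.
move=> cb; apply: conv_hull_le => _ [B /= BM <-].
rewrite (le_trans _ (cb B BM)) // [leRHS]big_mkcond /= ler_sum // => j _.
by rewrite indicatorE; case: (j \in B); rewrite ?mulr1 ?mulr0.
Qed.

Lemma base_class_card_le1 B i : B \in bases M -> (#|B :&: [set i; s i]| <= 1)%N.
Proof.
move=> BM; rewrite leqNgt; apply/negP => /card_gt1P[u [v []]].
rewrite !inE => /andP[uB uC] /andP[vB vC] uv.
have BE : B = [set u; v].
  apply/eqP; rewrite eq_sym finset.eqEcard cards2 uv cardM // andbT.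
  by apply/fintype.subsetP => z; rewrite !inE => /orP[/eqP ->|/eqP ->].
have := sM uv; rewrite -BE BM => /esym/negP; apply.
by case/orP: uC vC uv => /eqP -> /orP[/eqP ->|/eqP ->]; rewrite ?sK ?eqxx.
Qed.

(** Each relation is linear, so it is enough to check it on the bases; the equality is split into
    two inequalities. *)
Lemma base_polytope_facets x : base_polytope R M x ->
  [/\ forall i, 0 <= x 0 i, \sum_i x 0 i = 2
    & forall i, \sum_(j in [set i; s i]) x 0 j <= 1].
Proof.
move=> Px; split.
- move=> i; have := @base_polytope_le (fun j => - (j == i)%:R) 0 x _ Px.
  rewrite (bigD1 i) //= eqxx mulN1r big1 ?addr0 ?oppr_le0; last first.
    by move=> j /negbTE ->; rewrite oppr0 mul0r.
  apply=> B _; rewrite sumrN oppr_le0; apply: sumr_ge0 => j _; exact: ler0n.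
- apply/eqP; rewrite eq_le; apply/andP; split.
    have := @base_polytope_le (fun=> 1) 2 x _ Px.
    under eq_bigr do rewrite mul1r; apply=> B BM.
    by rewrite sumr_const cardM.
  have := @base_polytope_le (fun=> -1) (-2) x _ Px.
  under eq_bigr do rewrite mulN1r; rewrite sumrN lerN2; apply=> B BM.
  by rewrite sumr_const cardM // mulNrn.
- move=> i; have := @base_polytope_le (fun j => (j \in [set i; s i])%:R) 1 x _ Px.
  under eq_bigr do rewrite mulrC mulr_natr mulrb.
  rewrite -big_mkcond; apply=> B BM; rewrite -natr_sum.
  rewrite (_ : (\sum_(j in B) _)%N = #|B :&: [set i; s i]|).
    by rewrite lern1 base_class_card_le1.
  rewrite -sum1_card [LHS]big_mkcond [RHS]big_mkcond /=.
  by apply: eq_bigr => j _; rewrite [in RHS]inE; do 2!case: (j \in _).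
Qed.

(** Forward, the relations of [base_polytope_facets] are multiplied by t. Backward, a decomposition
    into t bases exhibits the point as t times their average. *)
Lemma dilate_base_polytopeP t (z : 'rV[int]_n.+1) :
  dilate t (base_polytope R M) (map_mx intr z) <->
  exists2 f, f \in polytope_points s t & z = \row_i (f i : nat)%:Z.
Proof.
split.
  case=> x /base_polytope_facets [x0 xs xc] xz.
  have zE i : (z 0 i)%:~R = t%:R * x 0 i :> R.
    by have /rowP/(_ i) := xz; rewrite !mxE.
  have z0 i : 0 <= z 0 i by rewrite -(ler0z R) zE mulr_ge0.
  pose g (i : 'I_n.+1) : nat := absz (z 0 i).
  have gz i : (g i)%:Z = z 0 i by rewrite /g gez0_abs.
  have gE i : (g i)%:R = t%:R * x 0 i :> R by rewrite -zE -gz.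
  have gs : (\sum_i g i = t.*2)%N.
    apply/eqP; rewrite -(eqr_nat R) natr_sum; under eq_bigr do rewrite gE.
    by rewrite -mulr_sumr xs -natrM muln2.
  have gb i : (g i < t.*2.+1)%N by rewrite ltnS -gs leq_term_sum.
  have fE i : [ffun i => Ordinal (gb i)] i = g i :> nat by rewrite ffunE.
  exists [ffun i => Ordinal (gb i)]; last by apply/rowP => i; rewrite mxE fE gz.
  rewrite inE; apply/andP; split.
    by rewrite /sum_eq (eq_bigr g) ?gs.
  apply/forallP => i; rewrite /class_sum (eq_bigr g) //.
  rewrite -(ler_nat R) natr_sum; under eq_bigr do rewrite gE.
  by rewrite -mulr_sumr -[leRHS]mulr1 ler_wpM2l.
case=> f; rewrite inE => /andP[/eqP fs /forallP fc] ->.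
have [Bs BsM BsE] := base_decomposition sK sM fs fc.
case: t f fs fc Bs BsM BsE => [|t] f fs fc Bs BsM BsE.
  (* For t = 0 there is no average to take; any base gives a point, which is dilated to 0. *)
  have /set0Pn[B BM] := bases_neq0 M.
  exists (indicator R B).
    exists 1%N, (fun=> indicator R B), (fun=> 1).
    split=> //; first by move=> _; exists B.
      by rewrite big_ord1.
    by rewrite big_ord1 scale1r.
  rewrite scale0r; apply/rowP => i; rewrite !mxE BsE big_ord0 //.
have t0 : t.+1%:R != 0 :> R by rewrite pnatr_eq0.
exists (\sum_k t.+1%:R^-1 *: indicator R (Bs k)).
  exists t.+1, (fun k => indicator R (Bs k)), (fun=> t.+1%:R^-1).
  split=> //; first by move=> k; exists (Bs k) => //=; exact: BsM.
  - by move=> k; rewrite invr_ge0 ler0n.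
  - by rewrite sumr_const card_ord -[LHS]mulr_natr mulVf.
rewrite -scaler_sumr scalerA mulfV // scale1r; apply/rowP => i.
rewrite !mxE BsE summxE -pmulrn natr_sum; apply: eq_bigr => k _.
by rewrite indicatorE.
Qed.

Lemma lattice_count_base_polytope t :
  lattice_count (base_polytope R M) t = #|polytope_points s t|.
Proof.
pose F (f : {ffun 'I_n.+1 -> 'I_(t.*2).+1}) : 'rV[int]_n.+1 := \row_i (f i : nat)%:Z.
have Finj : injective F.
  move=> f g /rowP E; apply/ffunP => i; apply: val_inj; have := E i.
  by rewrite !mxE => -[].
rewrite /lattice_count (_ : [set z | _]%classic =
    [set` [fset F f | f in polytope_points s t]%fset]%classic).
  by rewrite set_fsetK card_imfset //= cardE.
apply/seteqP; split=> z /=.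
  by move/dilate_base_polytopeP => [f fP ->]; apply/imfsetP; exists f.
by case/imfsetP => f fP ->; apply/dilate_base_polytopeP; exists f.
Qed.

End LatticePoints.

(** Linearly independent points are affinely independent, and d + 1 of them span dimension d. *)
Lemma rank_le_affine_dim (R : realType) n (P : set 'rV[R]_n) m (p : 'I_m -> 'rV[R]_n) :
  (forall i, P (p i)) -> ((\rank (\matrix_i p i)).-1 <= affine_dim P)%N.
Proof.
move=> Pp; set A := \matrix_i p i.
case rA : (\rank A) => [|d] //=.
have [f ffree] : exists f : 'I_d.+1 -> 'I_m, row_free (rowsub f A).
  by rewrite -rA; exists (maxrankfun A); exact: maxrowsub_free.
have dn : (d < n.+1)%N by rewrite ltnS ltnW // -rA rank_leq_col.
rewrite /affine_dim; apply: (@leq_bigmax_cond _ _ (fun d : 'I_n.+1 => d : nat) (Ordinal dn)).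
apply/asboolP; exists (fun i => p (f i)) => //=; apply/inj_row_free => v vD.
(* A relation among differences becomes one among points: the base point receives minus the sum of
   the other coefficients. *)
pose u : 'rV[R]_d.+1 :=
  \row_k (if unlift ord0 k is Some i then v 0 i else - \sum_i v 0 i).
have uQ : u *m rowsub f A = 0.
  apply/rowP => j; rewrite !mxE big_ord_recl !mxE unlift_none.
  have /rowP/(_ j) := vD; rewrite !mxE => E; rewrite -[RHS]E.
  rewrite mulNr mulr_suml -sumrN -big_split /=.
  by apply: eq_bigr => i _; rewrite !mxE liftK /=; ring.
have u0 : u = 0 by apply/eqP; rewrite -(mulmx_free_eq0 _ ffree) uQ.
apply/rowP => i; have /rowP/(_ (lift ord0 i)) := u0.
by rewrite !mxE liftK.
Qed.

(** Differences of points of [P] lie in the kernel of [W]. *)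
Lemma affine_dim_le_corank (R : realType) n (P : set 'rV[R]_n) r (W : 'M[R]_(n, r)) c :
  (forall x, P x -> x *m W = c) -> (affine_dim P <= n - \rank W)%N.
Proof.
move=> PW; apply/bigmax_leqP => -[d dn] /asboolP[p Pp] /=.
set D := \matrix_i _ => /eqP rD; have DW : D *m W = 0.
  by apply/row_matrixP => i; rewrite row_mul rowK mulmxBl !PW // subrr row0.
by have := mulmx0_rank_max DW; rewrite rD; lia.
Qed.

Section Dimension.
Variables (R : realType) (n : nat) (M : matroid n.+1) (s : 'I_n.+1 -> 'I_n.+1).
Hypothesis sK : involutive s.
Hypothesis sM : forall a b, a != b -> ([set a; b] \in bases M) = (b != s a).
Hypothesis cardM : forall B, B \in bases M -> #|B| = 2%N.

(** [U] contains every vector orthogonal to all bases, so the indicators have rank at least n + 1 -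
    rank U; passing to affine dimension costs one. *)
Lemma affine_dim_base_polytope_ge m (U : 'M[R]_(m, n.+1)) :
    (forall w : 'rV[R]_n.+1,
      (forall a b, a \notin [set b; s b] -> w 0 a + w 0 b = 0) -> (w <= U)%MS) ->
  (n - \rank U <= affine_dim (base_polytope R M))%N.
Proof.
move=> wU; pose p (i : 'I_#|bases M|) := indicator R (enum_val i).
have Pp i : base_polytope R M (p i).
  exists 1%N, (fun=> p i), (fun=> 1); split=> //.
  - by move=> _; exists (enum_val i) => //=; exact: enum_valP.
  - by rewrite big_ord1.
  - by rewrite big_ord1 scale1r.
apply: leq_trans (rank_le_affine_dim Pp); set A := \matrix_i p i.
suff : (\rank (kermx A^T) <= \rank U)%N by rewrite mxrank_ker mxrank_tr; lia.
apply/mxrankS/row_subP => i; apply: wU => a b; set w := row i _ => ab.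
have nab : a != b by apply: contraNneq ab => ->; rewrite !inE eqxx.
have abM : [set a; b] \in bases M.
  by rewrite sM //; move: ab; rewrite mem_class_sym // !inE negb_or => /andP[].
have wA : w *m A^T = 0.
  by apply: sub_kermxP; exact: row_sub.
clearbody w; have /rowP/(_ (enum_rank_in abM [set a; b])) := wA.
rewrite [in RHS]mxE mxE => <-; under eq_bigr do rewrite !mxE indicatorE enum_rankK_in //.
rewrite (bigD1 a) //= (bigD1 b) 1?eq_sym //= big1 ?addr0.
  by rewrite !inE !eqxx /= ?orbT !mulr1 ?addr0.
by move=> j /andP[/negbTE ja /negbTE jb]; rewrite !inE ja jb mulr0.
Qed.

Lemma affine_dim_base_polytope_lt : (affine_dim (base_polytope R M) <= n)%N.
Proof.
have H x : base_polytope R M x -> x *m (const_mx 1 : 'cV_n.+1) = const_mx 2.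
  case/(base_polytope_facets sK sM cardM) => _ xs _; apply/rowP => j; rewrite !mxE.
  by rewrite -xs; apply: eq_bigr => i _; rewrite mxE mulr1.
apply: leq_trans (affine_dim_le_corank H) _; set r := \rank _.
suff : (0 < r)%N by lia.
rewrite lt0n mxrank_eq0; apply/eqP => /matrixP/(_ ord0 ord0)/eqP.
by rewrite !mxE oner_eq0.
Qed.

(** w_a + w_b = w_a + w_c = w_b + w_c = 0 forces w_a = 0, and any coordinate can play the part of
    [a]. *)
Lemma affine_dim_three_classes a b c :
    a \notin [set b; s b] -> a \notin [set c; s c] -> b \notin [set c; s c] ->
  affine_dim (base_polytope R M) = n.
Proof.
move=> ab ac bc; apply/eqP; rewrite eqn_leq affine_dim_base_polytope_lt /=.
have := @affine_dim_base_polytope_ge 1 0; rewrite mxrank0 subn0; apply=> w wP.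
have np x y z : x \in [set y; s y] -> y \notin [set z; s z] -> x \notin [set z; s z].
  move=> xy; apply: contra => xz.
  by rewrite -(class_eq_mem sK xz) mem_class_sym.
have w0 x y z : x \notin [set y; s y] -> x \notin [set z; s z] ->
    y \notin [set z; s z] -> w 0 x = 0.
  by move=> /wP xy /wP xz /wP yz; lra.
suff -> : w = 0 by rewrite sub0mx.
apply/rowP => x; rewrite [RHS]mxE.
have [xa|xa] := boolP (x \in [set a; s a]).
  by apply: (w0 x b c) => //; apply: np xa _.
have [xb|xb] := boolP (x \in [set b; s b]).
  by apply: (w0 x a c) => //; apply: np xb _.
exact: (w0 x a b).
Qed.

(** Both class sums are at most 1 and they add up to 2, so each equals 1: two independent equations.
    Conversely, a vector orthogonal to all bases is constant on one class and opposite on the other,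
    which leaves a line. *)
Lemma affine_dim_two_classes a b :
    (forall x, (x \in [set b; s b]) = (x \notin [set a; s a])) ->
  affine_dim (base_polytope R M) = n.-1.
Proof.
move=> ab; apply/eqP; rewrite eqn_leq; apply/andP; split.
  pose W : 'M[R]_(n.+1, 2) := \matrix_(j, k)
    (if k == ord0 then j \in [set a; s a] else j \in [set b; s b])%:R.
  have H x : base_polytope R M x -> x *m W = const_mx 1.
    case/(base_polytope_facets sK sM cardM) => _ xs xc.
    have E i : \sum_j x 0 j * (j \in [set i; s i])%:R = \sum_(j in [set i; s i]) x 0 j.
      rewrite [RHS]big_mkcond /=; apply: eq_bigr => j _.
      by case: (j \in _); rewrite ?mulr1 ?mulr0.
    move: xs (xc a) (xc b); rewrite (bigID (mem [set a; s a])) /=.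
    rewrite [X in _ + X](eq_bigl (fun j => j \in [set b; s b])) => [xs ca cb|j]; last first.
      by rewrite ab.
    apply/rowP => k; rewrite !mxE; under eq_bigr do rewrite mxE.
    by case: (k == ord0); rewrite E; lra.
  apply: leq_trans (affine_dim_le_corank H) _.
  suff : (2 <= \rank W)%N by lia.
  (* Rows [a] and [b] of [W] form the identity matrix. *)
  apply: (@mulmx1_min_rank _ _ _ _ W
    (\matrix_(k < 2) delta_mx 0 (if k == ord0 then a else b)) 1%:M).
  rewrite mulmx1; apply/row_matrixP => k; rewrite row_mul rowK -rowE; apply/rowP => l.
  have aa : a \in [set a; s a] by rewrite !inE eqxx.
  have bb : b \in [set b; s b] by rewrite !inE eqxx.
  have ba : b \in [set a; s a] = false by apply/negbTE; rewrite -ab.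
  have abF : a \in [set b; s b] = false by rewrite ab aa.
  rewrite !mxE; case: k => -[|[|//]] kP; case: l => -[|[|//]] lP /=.
  - by rewrite aa.
  - by rewrite abF.
  - by rewrite ba.
  - by rewrite bb.
pose U : 'rV[R]_n.+1 := \row_j (if j \in [set a; s a] then 1 else -1).
have := @affine_dim_base_polytope_ge 1 U; have := rank_leq_row U => rU H.
apply: leq_trans (H _); first by lia.
move=> w wP; have aa : a \in [set a; s a] by rewrite !inE eqxx.
have bb : b \in [set b; s b] by rewrite !inE eqxx.
have -> : w = w 0 a *: U; last by rewrite scalemx_sub.
apply/rowP => x; rewrite !mxE.
have wE y z : y \in [set a; s a] -> z \in [set b; s b] -> w 0 y = - w 0 z.
  move=> ya zb; apply/eqP; rewrite -addr_eq0; apply/eqP/wP.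
  by rewrite (class_eq_mem sK zb) ab ya.
case: ifPn => xa; first by rewrite mulr1 (wE _ _ xa bb) -(wE _ _ aa bb).
by rewrite mulrN1 (wE a x) // ?opprK // ab.
Qed.

End Dimension.

(** * Small ground sets and conclusion *)

Section SmallCases.
Variable R : comNzRingType.

(** For n < 6 nothing lies beyond x^2; integer coefficients let each instance close by
    computation. *)
Let coefs_le2 n l (c1 c2 : int) : (n < 6)%N ->
    'C(n, 2)%:Z - (n + l)%:Z = c1 -> 'C(n, 4)%:Z - (l * (n - 3))%:Z = c2 ->
  rank2_hstar_poly R n l = 1 + c1%:~R *: 'X + c2%:~R *: 'X^2.
Proof.
move=> n6 <- <-; rewrite !rmorphB /= -!pmulrn; apply/polyP => j.
rewrite coef_rank2_hstar_poly !coefD coef1 !coefZ coefX coefXn.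
case: j => [|[|[|j]]] /=; rewrite ?mulr0 ?mulr1 ?addr0 ?add0r ?subr0 ?bin0 //.
by rewrite bin_small //; lia.
Qed.

(** From here on, the pairs (n, l) with n <= 4 and at least two classes; those with n - l = 2 show a
    factor 1 - x. *)
Lemma rank2_hstar_poly20 : rank2_hstar_poly R 2 0 = 1 - 'X.
Proof. by rewrite (@coefs_le2 2 0 (-1) 0) // scale0r addr0 scaleN1r. Qed.

Lemma rank2_hstar_poly30 : rank2_hstar_poly R 3 0 = 1.
Proof. by rewrite (@coefs_le2 3 0 0 0) // !scale0r !addr0. Qed.

Lemma rank2_hstar_poly31 : rank2_hstar_poly R 3 1 = 1 - 'X.
Proof. by rewrite (@coefs_le2 3 1 (-1) 0) // scale0r addr0 scaleN1r. Qed.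

Lemma rank2_hstar_poly40 : rank2_hstar_poly R 4 0 = ('X + 1) ^+ 2.
Proof. by rewrite (@coefs_le2 4 0 2 1) // scale1r scaler_nat; ring. Qed.

Lemma rank2_hstar_poly41 : rank2_hstar_poly R 4 1 = 1 + 'X.
Proof. by rewrite (@coefs_le2 4 1 1 0) // scale0r addr0 scale1r. Qed.

Lemma rank2_hstar_poly42 : rank2_hstar_poly R 4 2 = (1 - 'X) * (1 + 'X).
Proof. by rewrite (@coefs_le2 4 2 0 (-1)) // scale0r scaleN1r; ring. Qed.

End SmallCases.

Lemma real_rooted_sqrXD1 (R : realType) : real_rooted (('X + 1) ^+ 2 : {poly R}).
Proof.
have mon : 'X + 1 = 'X - (-1)%:P :> {poly R} by rewrite polyCN opprK.
apply: (@real_rooted_of_roots _ _ [:: -1]) => //.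
- by rewrite mon expf_neq0 // polyXsubC_eq0.
- by rewrite /= andbT mon expr2 rootM root_XsubC eqxx.
- by rewrite mon size_exp_XsubC.
Qed.

Section Representatives.
Variables (n : nat) (s : 'I_n -> 'I_n).
Hypothesis sK : involutive s.

Local Notation reps := [set i : 'I_n | i <= s i]%N.

Lemma rep_neq i j : i \in reps -> j \in reps -> i != j -> i \notin [set j; s j].
Proof.
rewrite !inE => ri rj ij; rewrite (negbTE ij) /=; apply: contra ij => /eqP E.
by apply/eqP/val_inj/eqP; rewrite eqn_leq {2}E rj andbT; move: ri; rewrite {2}E sK.
Qed.

Lemma exists_rep i : exists2 j, j \in reps & i \in [set j; s j].
Proof.
have [ri|/ltnW ri] := leqP i (s i); first by exists i; rewrite !inE ?eqxx.
by exists (s i); rewrite !inE ?sK ?eqxx ?orbT.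
Qed.

Lemma card_reps_gt1 a b : b \notin [set a; s a] -> (1 < #|reps|)%N.
Proof.
move=> ab; have [i ri ai] := exists_rep a; have [j rj bj] := exists_rep b.
apply/card_gt1P; exists i, j; split=> //; apply: contra ab => /eqP E.
by rewrite (class_eq_mem sK ai) E.
Qed.

End Representatives.

Theorem theorem1p3 (R : realType) (n : nat) (M : matroid n)
    (sparseM : sparse_paving M) (rankM : matroid_rank M = 2%N) :
  let h := hstar (base_polytope R M) in
  [\/ h = 1,
      h = 1 + 'X
    | [/\ real_rooted h,
          size h = (n./2).+1
        & forall i : nat, (i <= n./2)%N -> 0 < h`_i]].
Proof.
have cardM := card_base2 rankM; have [s sK sM] := exists_partner sparseM rankM.
have /set0Pn[B BM] := bases_neq0 M.
have /eqP/cards2P[a [b [ab BE]]] := cardM B BM.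
(* The two elements of a base lie in different classes. *)
have r2 : (1 < #|[set i : 'I_n | i <= s i]%N|)%N.
  apply: (card_reps_gt1 sK (a := a) (b := b)).
  by rewrite !inE negb_or eq_sym ab -sM // -BE.
case: n M sparseM rankM s {a b ab BE} B BM cardM sK sM r2 => [|n] M sparseM rankM s B BM
  cardM sK sM r2 h; first by have := leq_trans r2 (max_card _); rewrite card_ord.
have repE := num_reps_add_pairs sK; have ln := num_pairs_le sK.
set l := num_pairs s in repE ln.
have l0 : (l == 0%N) || (2 < n.+1)%N by lia.
have [q qE] := rank2_ehrhart_poly R (ltac:(lia) : 1 < n.+1)%N l0.
have hP g : has_numerator (affine_dim (base_polytope R M)).+1 (rank2_ehrhart R n.+1 l) g ->
    h = g.
  apply: hstar_unique qE => t.
  by rewrite (lattice_count_base_polytope R sK sM cardM) card_polytope_points.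
have HN := has_numerator_rank2_ehrhart R n.+1 l.
(* The number n + 1 - l of classes decides the dimension: n for three or more, n - 1 for two. *)
have [r3|r3] := ltnP 2 #|[set i : 'I_n.+1 | i <= s i]%N|.
  have /card_gt2P[i [j [k [[iR jR kR] [ij jk ki]]]]] := r3.
  have dimP : affine_dim (base_polytope R M) = n.
    by apply: (affine_dim_three_classes R sK sM cardM (a := i) (b := j) (c := k));
      apply: rep_neq; rewrite // eq_sym.
  have -> : h = rank2_hstar_poly R n.+1 l by apply: hP; rewrite dimP.
  have [n5|n5] := leqP 5 n.+1; first by constructor 3; exact: rank2_hstar_polyP.
  have [[-> ->]|[[-> ->]|[-> ->]]] : n = 2 /\ l = 0%N \/ n = 3 /\ l = 0%N \/ n = 3 /\ l = 1%N.
  - by lia.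
  - by constructor 1; rewrite rank2_hstar_poly30.
  - constructor 3; rewrite rank2_hstar_poly40; split; first exact: real_rooted_sqrXD1.
      have -> : 'X + 1 = 'X - (-1)%:P :> {poly R} by rewrite polyCN opprK.
      by rewrite size_exp_XsubC.
    by rewrite -rank2_hstar_poly40; case=> [|[|[|i']]] // _;
      rewrite coef_rank2_hstar_poly /= ?mulr0 ?mulr1 ?subr0 ?subr_gt0 ?ltr_nat ?ltr0n.
  - by constructor 2; rewrite rank2_hstar_poly41.
have /cards2P[i [j [ij rE]]] : #|[set i : 'I_n.+1 | i <= s i]%N| == 2%N.
  by rewrite eqn_leq r3.
have iR : i \in [set i : 'I_n.+1 | i <= s i]%N by rewrite rE !inE eqxx.
have jR : j \in [set i : 'I_n.+1 | i <= s i]%N by rewrite rE !inE eqxx orbT.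
have dimP : affine_dim (base_polytope R M) = n.-1.
  apply: (affine_dim_two_classes R sK sM cardM (a := i) (b := j)) => x.
  have ji : j \notin [set i; s i] by apply: rep_neq; rewrite // eq_sym.
  have [k kR xk] := exists_rep sK x; move: kR; rewrite rE => /set2P[] kE; rewrite kE in xk.
    rewrite (mem_class_sym sK) (class_eq_mem sK xk) (negbTE ji).
    by rewrite xk.
  by rewrite xk (mem_class_sym sK) (class_eq_mem sK xk) rep_neq.
have {}hP g : has_numerator n (rank2_ehrhart R n.+1 l) g -> h = g.
  by move=> Hg; apply: hP; rewrite dimP prednK //; lia.
(* Two classes of size at most 2 leave ground sets of 2, 3 or 4 elements; there the numerator loses
   its factor 1 - x. *)
have [[E1 E2]|[[E1 E2]|[E1 E2]]] :
    n = 1%N /\ l = 0%N \/ n = 2 /\ l = 1%N \/ n = 3 /\ l = 2.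
- by lia.
- rewrite E1 E2 rank2_hstar_poly20 -[1 - 'X]mulr1 in HN.
  by constructor 1; apply: hP; rewrite E1 E2; exact: has_numerator_cancel.
- rewrite E1 E2 rank2_hstar_poly31 -[1 - 'X]mulr1 in HN.
  by constructor 1; apply: hP; rewrite E1 E2; exact: has_numerator_cancel.
- rewrite E1 E2 rank2_hstar_poly42 in HN.
  by constructor 2; apply: hP; rewrite E1 E2; exact: has_numerator_cancel.
Qed.
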